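(* Let $k\geq 3$ and let $f_{k,j}$ be defined as in the context. Then for every $n\in\mathbb{N}$, $$f_{k,n}(\tau)=\frac{n\,g_{2,2k-1,n}(\tau)}{2^{n-1}}-\sum_{\ell=2}^{n-1}\binom{n-1}{\ell-1}f_{k,\ell}(\tau)\frac{(n-\ell)\,g_{2,2k-1,n-\ell}(\tau)}{2^{n-\ell-2}}$$ and $$f_{k,n}(\tau)=\sum_{\ell=2}^{n}\frac{\ell\, g_{2,2k-1,\ell}(\tau)}{2^{\ell-1}}\frac{(n-1)!}{(\ell-1)!}\mathrm{Tr}_{n-\ell}(\psi,f_k;\tau),$$ where $\psi(\lambda)=(-1)^{\sum_{m}\ell_m}\phi(\lambda)$.
   Context: $\tau\in\mathbb{H}$, $q=e^{2\pi i\tau}$, $\zeta=e^{2\pi iz}$, $(a)_n=\prod_{m=0}^{n-1}(1-aq^m)$. For $k\ge3$, $FG_k(\zeta,q)=\sum_{n_{k-1}\geq\dots\geq n_1\geq 1}\frac{q^{n_1^2+\dots+n_{k-1}^2}}{(q)_{n_{k-1}-n_{k-2}}\cdots(q)_{n_2-n_1}(\zeta q)_{n_1}(\zeta^{-1}q)_{n_1}}$ (generating function of Garvan's $k$-rank), and $\theta_{a,b}(\tau)=\sum_{n\in\mathbb{Z}}(-1)^nq^{(bn^2+an)/2}$. The functions $f_{k,j}$ ($j\in\mathbb{N}$) are defined by the identity (as power series in $z$ near $0$) $$FG_k(\zeta,q)+\frac{\theta_{1,2k-1}(\tau)}{(q)_\infty}=\frac{\sin(\pi z)}{\pi z(q)_\infty}\exp\left(2\sum_{j\ge1}f_{k,j}(\tau)\frac{(2\pi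 iz)^j}{j!}\right).$$ For integers $a,b$: $g_{a,b,0}:=1$, $g_{a,b,\ell}:=0$ for odd $\ell$, and for even $\ell\ge2$ $$g_{a,b,\ell}(\tau)=(1-2^{\ell-1})\frac{B_\ell}{2\ell}+\sum_{\substack{m,n\ge1\\ an-1\geq bm\geq b}}(an-bm)^{\ell-1}q^{mn}-\sum_{\substack{m,n\ge1\\ m-1\geq abn\geq ab}}(m-abn)^{\ell-1}q^{mn},$$ $B_\ell$ the Bernoulli numbers. For $\lambda=(1^{\ell_1},\dots,n^{\ell_n})\vdash n$, $f_\lambda=\prod_m f_{k,m}^{\ell_m}$, $\phi(\lambda)=\prod_m\frac{2^{\ell_m}}{\ell_m!\,m!^{\ell_m}}$, and $\mathrm{Tr}_n(\psi,f_k;\tau)=\sum_{\lambda\vdash n}\psi(\lambda)f_\lambda(\tau)$ ($\mathrm{Tr}_0=1$). *)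

(* Defs.v *)
From HB Require Import structures.
From mathcomp Require Import all_boot all_order all_algebra.
From mathcomp Require Import finmap complex.
From mathcomp Require Import all_classical all_reals all_analysis.
From mathcomp Require Import showcase.summability.

Set Implicit Arguments.
Unset Strict Implicit.
Unset Printing Implicit Defensive.

Import Order.TTheory GRing.Theory Num.Theory.
Import numFieldNormedType.Exports.

Local Open Scope classical_set_scope.
Local Open Scope ring_scope.

(* The modulus topology on R[i]: real-closed provides only the algebraic
   structure and the norm. *)
HB.instance Definition _ (R : rcfType) := NormedModule.copy R[i] R[i]^o.

Section ComplexFunctions.
Variable R : realType.
Implicit Types z tau q a zeta : R[i].

Definition cexp z : R[i] :=
  (expR (complex.Re z))%:C%C *
  Complex (cos (complex.Im z)) (sin (complex.Im z)).

Definition csin z : R[i] :=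
  (cexp ('i%C * z) - cexp (- ('i%C * z))) / (2 * 'i%C).

Definition cpi : R[i] := (pi : R)%:C%C.

Definition two_pi_i : R[i] := 2 * cpi * 'i%C.

Definition upper_half_plane : set R[i] := [set tau | 0 < complex.Im tau].

Definition nome tau : R[i] := cexp (two_pi_i * tau).

(* Sum of F over the indices satisfying P, as the limit along the net of
   finite subsets of I. *)
Definition sum_over (I : choiceType) (P : pred I) (F : I -> R[i]) : R[i] :=
  summability.sum (fun i => if P i then F i else 0).

Definition qpoch a q (n : nat) : R[i] := \prod_(m < n) (1 - a * q ^+ m).

Definition euler_prod q : R[i] := lim (qpoch q q n @[n --> \oo]).

(* A tuple t stands for (n_1, ..., n_{k-1}), with n_i = nth 0 t i.-1. *)
Definition FG_index (k : nat) (t : (k.-1).-tuple nat) : bool :=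
  sorted leq t && (1 <= nth 0 t 0)%N.

Definition FG_term (k : nat) zeta q (t : (k.-1).-tuple nat) : R[i] :=
  let n_ i := nth 0%N t i.-1 in
  q ^+ (\sum_(1 <= i < k) n_ i ^ 2)%N /
  ((\prod_(1 <= i < k.-1) qpoch q q (n_ i.+1 - n_ i)%N) *
   qpoch (zeta * q) q (n_ 1%N) * qpoch (zeta^-1 * q) q (n_ 1%N)).

Definition FG (k : nat) zeta q : R[i] :=
  sum_over (@FG_index k) (@FG_term k zeta q).

(* q^x is read as exp(2 pi i tau x), since (b n^2 + a n) / 2 may be a
   half-integer. *)
Definition theta (a b : int) tau : R[i] :=
  sum_over xpredT (fun n : int =>
    (-1) ^ n * cexp (two_pi_i * tau * ((b * n ^+ 2 + a * n)%:~R / 2))).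

(* Partial sums of \sum_(j >= 1) f_j(tau) (2 pi i z)^j / j!. *)
Definition exponent_psum (f : nat -> R[i] -> R[i]) tau z (N : nat) : R[i] :=
  \sum_(1 <= j < N) f j tau * (two_pi_i * z) ^+ j / j`!%:R.

(* f = (f_{k,j})_j; the value f 0 is irrelevant.  The neighbourhood of 0 is
   punctured because sin(pi z) / (pi z) is 0 at z = 0 under x / 0 = 0. *)
Definition krank_expansion (k : nat) (f : nat -> R[i] -> R[i]) : Prop :=
  forall tau, upper_half_plane tau ->
  \forall z \near (0 : R[i])^',
    cvg (exponent_psum f tau z N @[N --> \oo]) /\
    FG k (cexp (two_pi_i * z)) (nome tau)
      + theta 1 (2 * k%:Z - 1) tau / euler_prod (nome tau)
    = csin (cpi * z) / (cpi * z * euler_prod (nome tau))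
      * cexp (2 * lim (exponent_psum f tau z N @[N --> \oo])).

(* The list [:: B_0; ...; B_n], from \sum_(j <= m) 'C(m+1, j) B_j = 0 for
   m >= 1. *)
Fixpoint bernoulli_seq (n : nat) : seq rat :=
  if n is m.+1 then
    let s := bernoulli_seq m in
    rcons s (- (\sum_(j < n) 'C(n.+1, j)%:R * s`_j) / n.+1%:R)
  else [:: 1].

Definition bernoulli_number (n : nat) : rat := (bernoulli_seq n)`_n.

(* In both sums a pair p is (m, n). *)
Definition g (a b : int) (l : nat) tau : R[i] :=
  if l == 0%N then 1 else if odd l then 0 else
  (1 - 2 ^+ l.-1) * (ratr (bernoulli_number l) / (2 * l%:R))
  + sum_over
      (fun p : nat * nat => [&& (1 <= p.1)%N, (1 <= p.2)%N,
         b * p.1%:Z <= a * p.2%:Z - 1 & b <= b * p.1%:Z])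
      (fun p => (a * p.2%:Z - b * p.1%:Z)%:~R ^+ l.-1
                * nome tau ^+ (p.1 * p.2)%N)
  - sum_over
      (fun p : nat * nat => [&& (1 <= p.1)%N, (1 <= p.2)%N,
         a * b * p.2%:Z <= p.1%:Z - 1 & a * b <= a * b * p.2%:Z])
      (fun p => (p.1%:Z - a * b * p.2%:Z)%:~R ^+ l.-1
                * nome tau ^+ (p.1 * p.2)%N).

(* A partition of n is given by its multiplicities: lam i is the number of
   parts equal to i.+1. *)
Definition multiplicities (n : nat) := {ffun 'I_n -> 'I_n.+1}.

Definition is_partition (n : nat) (lam : multiplicities n) : bool :=
  (\sum_(i < n) i.+1 * lam i == n)%N.

Definition f_partition (f : nat -> R[i] -> R[i]) tau
    (n : nat) (lam : multiplicities n) : R[i] :=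
  \prod_(i < n) f i.+1 tau ^+ lam i.

Definition phi (n : nat) (lam : multiplicities n) : R[i] :=
  \prod_(i < n) (2 ^+ lam i / ((lam i)`!%:R * (i.+1)`!%:R ^+ lam i)).

Definition psi (n : nat) (lam : multiplicities n) : R[i] :=
  (-1) ^+ (\sum_(i < n) lam i)%N * phi lam.

Definition Tr (n : nat) (w : forall m, multiplicities m -> R[i])
    (f : nat -> R[i] -> R[i]) tau : R[i] :=
  \sum_(lam : multiplicities n | is_partition lam)
    w n lam * f_partition f tau lam.

End ComplexFunctions.

Arguments psi {R} n lam.

(* Main.v *)
(* Write b = 2k - 1, y = pi i z and zeta = e^(2y).  Partial fractions in
   zeta + 1/zeta give the Bailey pair (relative to a = 1) with beta_0 = 0 and
   beta_n = 1/((zeta q)_n (q/zeta)_n) for n >= 1; running it k - 1 times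
   through the Bailey chain, i.e. through the q-Vandermonde sum, and letting
   the truncation tend to infinity yields Garvan's formula
     (q)_oo FG_k = sum_(r >= 1) (-1)^(r-1) q^(r(br-1)/2) (1 - q^r)(1 - q^(2r))
                                / ((1 - zeta q^r)(1 - q^r/zeta)).
   Adding theta_(1,b) and expanding geometric series, the left-hand side of the
   identity defining the f_(k,j), multiplied by (q)_oo, becomes
     1 + 4 sinh y sum_(r >= 1, s odd >= 1) (-1)^(r-1) q^(r(br+s)/2) sinh(s y).
   The moments of the weights (-1)^(r-1) q^(r(br+s)/2) in s are the
   non-constant parts of the g_(2,b,l): the terms with m even of the two sums
   defining g cancel, and the terms with m odd give r odd and r even.  The
   constant parts are the Taylor coefficients of y / sinh y.  Hence
     exp (2 sum_j f_(k,j) (2y)^j / j!) = 1 + 4 sum_(l >= 1) g_(2,b,l) y^l / (l-1)!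
   to every order at y = 0, and both formulas follow by comparing coefficients
   in E' = U' E and U' = E' exp(-U), where E = exp U. *)
Require Import Defs.
From mathcomp Require Import all_boot all_order all_algebra.
From mathcomp Require Import finmap complex.
From mathcomp Require Import all_classical all_reals all_analysis.
From mathcomp Require Import showcase.summability.
From mathcomp Require Import ring lra zify.

Set Implicit Arguments.
Unset Strict Implicit.
Unset Printing Implicit Defensive.

Import Order.TTheory GRing.Theory Num.Theory.
Import numFieldNormedType.Exports.

Local Open Scope ring_scope.

(** Each function of y is approximated by a polynomial up to O(|y|^N) for y <> 0, such a polynomial
    is unique modulo X^N, and so all coefficients are compared in [{poly F}] modulo X^N. Dividing by
    sinh y costs one order, which explains the pairs [N], [N.+1]. The chain is run only k - 2 times
    inside FG_k, because the sum over n_(k-1) carries no factor 1/(q)_(n - n_(k-1)). The last step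
    is taken in the limit n -> oo of sum_m b_m / (q)_(n-m) = sum_r q^((k-1) r^2) alpha_r /
    ((q)_(n-r) (q)_(n+r)), whose sides tend to FG_k / (q)_oo and to sum_r q^((k-1) r^2) alpha_r /
    (q)_oo^2; this is the origin of the factor (q)_oo. All infinite sums are limits over finite sets
    of indices, so every rearrangement rests on an absolute bound by a geometric series. For the
    double sum in (r, s) the bound must be uniform for small y and survive powers of s, which limits
    y to a disc depending on |q|. *)

Section FormalSeries.
Variable F : numFieldType.
Implicit Types (p q r u v w : {poly F}) (N n : nat).

(** * Power series truncated modulo X^N, and their exponential *)

Definition eqmodX N p q := forall i, (i < N)%N -> p`_i = q`_i.

Lemma eqmodX_sym N p q : eqmodX N p q -> eqmodX N q p.
Proof. by move=> h i /h. Qed.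

Lemma eqmodX_trans N q p r : eqmodX N p q -> eqmodX N q r -> eqmodX N p r.
Proof. by move=> h h' i iN; rewrite h// h'. Qed.

Lemma eqmodX_leq M N p q : (M <= N)%N -> eqmodX N p q -> eqmodX M p q.
Proof. by move=> MN h i iM; rewrite h// (leq_trans iM). Qed.

Lemma eqmodXD N p p' q q' :
  eqmodX N p p' -> eqmodX N q q' -> eqmodX N (p + q) (p' + q').
Proof. by move=> h h' i iN; rewrite !coefD h// h'. Qed.

Lemma eqmodXN N p p' : eqmodX N p p' -> eqmodX N (- p) (- p').
Proof. by move=> h i iN; rewrite !coefN h. Qed.

Lemma eqmodXZ N a p p' : eqmodX N p p' -> eqmodX N (a *: p) (a *: p').
Proof. by move=> h i iN; rewrite !coefZ h. Qed.

Lemma eqmodXM N p p' q q' :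
  eqmodX N p p' -> eqmodX N q q' -> eqmodX N (p * q) (p' * q').
Proof.
move=> h h' i iN; rewrite !coefM; apply: eq_bigr => j _.
rewrite h ?h'//; first exact: leq_ltn_trans (leq_subr _ _) iN.
by apply: leq_ltn_trans iN; rewrite -ltnS.
Qed.

Lemma eqmodX_sum N (I : Type) (s : seq I) (P : pred I) (G G' : I -> {poly F}) :
  (forall i, P i -> eqmodX N (G i) (G' i)) ->
  eqmodX N (\sum_(i <- s | P i) G i) (\sum_(i <- s | P i) G' i).
Proof.
by move=> h; elim/big_ind2 : _ => // p p' q q'; apply: eqmodXD.
Qed.

Lemma eqmodX_exp N p q j : eqmodX N p q -> eqmodX N (p ^+ j) (q ^+ j).
Proof. by move=> h; elim: j => // j ih; rewrite !exprS; apply: eqmodXM. Qed.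

Lemma eqmodX_mulX N p q : eqmodX N.+1 ('X * p) ('X * q) -> eqmodX N p q.
Proof.
by move=> h i iN; have := h i.+1 iN; rewrite !coefXM.
Qed.

Lemma coef0_mulX p : p`_0 = 0 -> exists q, p = 'X * q.
Proof.
move=> p0; exists (drop_poly 1 p).
rewrite -[LHS](poly_take_drop 1) expr1 mulrC [X in X + _](_ : _ = 0) ?add0r//.
by apply/polyP => -[|i]; rewrite coef_take_poly coef0//= p0.
Qed.

Lemma eqmodX_pow0 N p j : p`_0 = 0 -> (N <= j)%N -> eqmodX N (p ^+ j) 0.
Proof.
move=> /coef0_mulX[q ->] Nj i iN.
by rewrite exprMn mulrC coefMXn coef0 (leq_trans iN Nj).
Qed.

Lemma eqmodX_cancel N p q r :
  p`_0 != 0 -> eqmodX N (p * q) (p * r) -> eqmodX N q r.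
Proof.
move=> p0 h; elim/ltn_ind => i ih iN.
have := h i iN; rewrite !coefM !big_ord_recl /= !subn0.
rewrite (eq_bigr (fun j : 'I_i => p`_(bump 0 j) * r`_(i - bump 0 j))).
  by move/addIr/(mulfI p0).
move=> j _; rewrite /bump leq0n add1n.
have ij : (i - j.+1 < i)%N by rewrite ltn_subrL /= (leq_ltn_trans _ (ltn_ord j)).
by rewrite ih// (ltn_trans ij).
Qed.

Definition expp N u : {poly F} := \sum_(j < N) j`!%:R^-1 *: u ^+ j.

Lemma factnz n : n`!%:R != 0 :> F.
Proof. by rewrite pnatr_eq0 -lt0n fact_gt0. Qed.

(** An exact equality, not one modulo a power of X: differentiation lowers the truncation by one,
    and [expp_succ] makes up for it when u has no constant term. *)
Lemma expp_deriv N u : (expp N.+1 u)^`() = u^`() * expp N u.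
Proof.
rewrite /expp big_ord_recl /= expr0 derivD derivZ derivC scaler0 add0r.
rewrite raddf_sum mulr_sumr; apply: eq_bigr => i _.
rewrite /bump /= add1n derivZ deriv_exp /= -[_ *+ i.+1]scaler_nat scalerA -scalerAr.
by rewrite factS natrM invfM mulrAC mulVf ?mul1r// pnatr_eq0.
Qed.

Lemma expp_succ N u : u`_0 = 0 -> eqmodX N (expp N.+1 u) (expp N u).
Proof.
move=> u0; rewrite /expp big_ord_recr /= -[X in eqmodX _ _ X]addr0.
apply: eqmodXD => //; rewrite -[X in eqmodX _ _ X](scaler0 _ N`!%:R^-1).
exact/eqmodXZ/eqmodX_pow0.
Qed.

Lemma expp_coef0 N u : u`_0 = 0 -> (expp N.+1 u)`_0 = 1.
Proof.
move=> u0; rewrite /expp big_ord_recl /= expr0 invr1 scale1r coefD coef1 /=.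
rewrite coef_sum big1 ?addr0// => i _; rewrite coefZ.
by rewrite (@eqmodX_pow0 1 u)// ?coef0 ?mulr0.
Qed.

(** The equation p' = w p gives each coefficient from the earlier ones, since i + 1 is invertible;
    one order is gained. It proves [exppD] without a binomial expansion. *)
Lemma ode_uniq N w p q : eqmodX N p^`() (w * p) -> eqmodX N q^`() (w * q) ->
  p`_0 = q`_0 -> eqmodX N.+1 p q.
Proof.
move=> hp hq pq0; elim/ltn_ind => -[//|i] ih iN.
have := hp i iN; have := hq i iN; rewrite !coef_deriv !coefM => hq' hp'.
have i1 : i.+1%:R != 0 :> F by rewrite pnatr_eq0.
apply: (mulIf i1); rewrite !mulr_natr hp' hq'; apply: eq_bigr => j _.
have ji : (i - j < i.+1)%N by rewrite ltnS leq_subr.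
by rewrite ih// (leq_trans ji)// ltnW.
Qed.

Lemma expp_ode N u : u`_0 = 0 ->
  eqmodX N (expp N.+1 u)^`() (u^`() * expp N.+1 u).
Proof.
by move=> u0; rewrite expp_deriv; apply: eqmodXM => //; exact/eqmodX_sym/expp_succ.
Qed.

Lemma exppD N u v : u`_0 = 0 -> v`_0 = 0 ->
  eqmodX N (expp N (u + v)) (expp N u * expp N v).
Proof.
case: N => [|N] u0 v0; first by [].
apply: (@ode_uniq _ (u^`() + v^`())).
- by rewrite -derivD; apply: expp_ode; rewrite coefD u0 v0 addr0.
- rewrite derivM (_ : _ * (_ * _) = (u^`() * expp N.+1 u) * expp N.+1 v +
    expp N.+1 u * (v^`() * expp N.+1 v)); last by ring.
  by apply: eqmodXD; apply: eqmodXM => //; exact: expp_ode.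
- by rewrite expp_coef0 ?coefD ?u0 ?v0 ?addr0// coefM big_ord1 !expp_coef0// mulr1.
Qed.

Lemma expp0 N : expp N.+1 0 = 1.
Proof.
rewrite /expp big_ord_recl /= expr0 invr1 scale1r big1 ?addr0// => i _.
by rewrite expr0n scaler0.
Qed.

Lemma exppN N u : u`_0 = 0 -> eqmodX N (expp N u * expp N (- u)) 1.
Proof.
case: N => [//|N] u0; rewrite -(expp0 N) -(subrr u).
by apply/eqmodX_sym/exppD; rewrite // coefN u0 oppr0.
Qed.

Lemma expp_sum N (I : Type) (s : seq I) (G : I -> {poly F}) :
  (forall i, (G i)`_0 = 0) ->
  eqmodX N (expp N (\sum_(i <- s) G i)) (\prod_(i <- s) expp N (G i)).
Proof.
case: N => [//|N] G0; elim: s => [|i s ih]; first by rewrite !big_nil expp0.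
rewrite !big_cons; apply: (@eqmodX_trans _ (expp N.+1 (G i) * expp N.+1 (\sum_(j <- s) G j))).
  by apply: exppD; rewrite // coef_sum big1.
exact: eqmodXM.
Qed.

Lemma coef_exppX N a i : (i < N)%N -> (expp N (a *: 'X))`_i = a ^+ i / i`!%:R.
Proof.
move=> iN; rewrite /expp coef_sum (bigD1 (Ordinal iN)) //= big1 ?addr0.
  by rewrite coefZ exprZn coefZ coefXn eqxx mulr1 mulrC.
move=> j; rewrite -val_eqE /= => ji; rewrite coefZ exprZn coefZ coefXn.
by rewrite eq_sym (negPf ji) !mulr0.
Qed.

Lemma expp_eqmodX N u v : eqmodX N u v -> eqmodX N (expp N u) (expp N v).
Proof.
by move=> uv; apply: eqmodX_sum => j _; apply/eqmodXZ/eqmodX_exp.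
Qed.

End FormalSeries.

(** * Bernoulli numbers and the expansion of X / sinh X *)

Lemma size_bernoulli_seq n : size (bernoulli_seq n) = n.+1.
Proof. by elim: n => //= n ih; rewrite size_rcons ih. Qed.

Lemma nth_bernoulli_seq n j : (j <= n)%N ->
  (bernoulli_seq n)`_j = bernoulli_number j.
Proof.
elim: n => [|n ih]; first by rewrite leqn0 => /eqP ->.
rewrite leq_eqVlt => /predU1P[-> //|jn].
by rewrite /= nth_rcons size_bernoulli_seq jn ih.
Qed.

Lemma bernoulli_sum n :
  \sum_(j < n.+1) 'C(n.+1, j)%:R * bernoulli_number j = (n == 0%N)%:R.
Proof.
case: n => [|n]; first by rewrite big_ord1 bin0 mul1r.
rewrite big_ord_recr /= {2}/bernoulli_number /=.
rewrite nth_rcons size_bernoulli_seq ltnn eqxx.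
have n2 : n.+2%:R != 0 :> rat by rewrite pnatr_eq0.
rewrite binSn mulrC mulfVK//; apply/eqP; rewrite subr_eq0; apply/eqP.
apply: eq_bigr => j _; rewrite nth_bernoulli_seq//.
by rewrite -ltnS.
Qed.

Section Formal.
Variable F : numFieldType.
Implicit Types (N n : nat) (a : F).

Lemma expp_leq M N (u : {poly F}) : u`_0 = 0 -> (M <= N)%N ->
  eqmodX M (expp N u) (expp M u).
Proof.
move=> u0; elim: N => [|N ih]; first by rewrite leqn0 => /eqP ->.
rewrite leq_eqVlt => /predU1P[-> //|MN].
by apply: eqmodX_trans (ih MN); apply: eqmodX_leq (expp_succ u0).
Qed.

(** The truncation of aX / (exp(aX) - 1), with B_1 = -1/2. *)
Definition bern_poly N a : {poly F} :=
  \poly_(i < N) (ratr (bernoulli_number i) * a ^+ i / i`!%:R).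

(* The truncation of a X / sinh (a X), and below that of 2 sinh (a X). *)
Definition csch_poly N a : {poly F} := 2 *: bern_poly N a - bern_poly N (2 * a).

Lemma aX_coef0 a : (a *: 'X : {poly F})`_0 = 0.
Proof. by rewrite coefZ coefX mulr0. Qed.

Lemma bern_poly_mul N a :
  eqmodX N ((expp N (a *: 'X) - 1) * bern_poly N a) (a *: 'X).
Proof.
move=> n nN; rewrite mulrC coefM coefZ coefX.
case: n nN => [|n] nN.
  rewrite big_ord1 coefB coef1 coef_exppX//= expr0 fact0 divr1 subrr mulr0.
  by rewrite mulr0.
rewrite big_ord_recr /= subnn coefB coef1 coef_exppX ?(leq_trans _ nN)//=.
rewrite expr0 fact0 divr1 subrr mulr0 addr0.
transitivity (ratr (n == 0%N)%:R * a ^+ n.+1 / n.+1`!%:R : F); last first.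
  case: n {nN} => [|n]; first by rewrite rmorph1 divr1 mul1r mulr1.
  by rewrite rmorph0 !mul0r mulr0.
rewrite -bernoulli_sum rmorph_sum /= !mulr_suml; apply: eq_bigr => j _.
have jn := ltn_ord j.
rewrite coef_poly (ltn_trans jn nN) coefB coef1 coef_exppX; last first.
  exact: leq_ltn_trans (leq_subr _ _) nN.
rewrite subn_eq0 leqNgt jn subr0 rmorphM /= ratr_nat.
rewrite -[in a ^+ n.+1](subnKC (ltnW jn)) exprD.
rewrite -(bin_fact (ltnW jn)) !natrM.
have [b0 f1 f2] : [/\ 'C(n.+1, j)%:R != 0 :> F, j`!%:R != 0 :> F &
  (n.+1 - j)`!%:R != 0 :> F].
  by rewrite !factnz pnatr_eq0 -lt0n bin_gt0 ltnW.
by field; rewrite b0 f1 f2.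
Qed.

Lemma coef_csch_poly N a i : (i < N)%N ->
  (csch_poly N a)`_i =
  (2 - 2 ^+ i) * ratr (bernoulli_number i) * a ^+ i / i`!%:R.
Proof.
move=> iN; rewrite coefB coefZ !coef_poly iN exprMn.
by have := factnz F i => f0; field.
Qed.

Definition sinh2_poly N a : {poly F} := expp N (a *: 'X) - expp N (- (a *: 'X)).

(** With e = exp(aX), 2aX / (e - 1) - 2aX / (e^2 - 1) = 2aX e / (e^2 - 1) = 2aX / (e - 1/e). *)
Lemma csch_poly_mul N a :
  eqmodX N (sinh2_poly N a * csch_poly N a) ((2 * a) *: 'X).
Proof.
set e := expp N (a *: 'X); set e' := expp N (- (a *: 'X)).
have ee' : eqmodX N (e * e') 1 by apply: exppN; exact: aX_coef0.
have e2 : eqmodX N (expp N ((2 * a) *: 'X)) (e * e).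
  rewrite mulrC mulr_natr mulr2n scalerDl; apply: exppD; exact: aX_coef0.
have h1 := @bern_poly_mul N a; have h2 := @bern_poly_mul N (2 * a).
rewrite -/e in h1.
have h2' : eqmodX N ((e * e - 1) * bern_poly N (2 * a)) ((2 * a) *: 'X).
  apply: eqmodX_trans h2; apply: eqmodXM => //; apply: eqmodXD => //.
  exact: eqmodX_sym.
have h3 : eqmodX N ((e * e - 1) * csch_poly N a) ((2 * a) *: 'X * e).
  rewrite (_ : _ * csch_poly N a = (2 *: (e + 1)) * ((e - 1) * bern_poly N a)
    - (e * e - 1) * bern_poly N (2 * a)); last first.
    by rewrite /csch_poly -!mul_polyC; ring.
  rewrite (_ : _ *: 'X * e = (2 *: (e + 1)) * (a *: 'X) - (2 * a) *: 'X).
    apply: eqmodXD; [exact: eqmodXM|exact: eqmodXN].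
  by rewrite -!mul_polyC polyCM; ring.
have h4 : eqmodX N (e' * ((e * e - 1) * csch_poly N a))
                   (sinh2_poly N a * csch_poly N a).
  rewrite mulrA; apply: eqmodXM => //.
  rewrite (_ : e' * _ = e * (e * e') - e'); last by ring.
  rewrite /sinh2_poly -/e -/e' -[X in eqmodX _ _ (X - _)]mulr1.
  by apply: eqmodXD => //; apply: eqmodXM.
apply: eqmodX_trans (eqmodX_sym h4) _.
apply: (@eqmodX_trans _ _ (e' * ((2 * a) *: 'X * e))); first exact: eqmodXM.
rewrite (_ : e' * _ = (2 * a) *: 'X * (e * e')); last by ring.
by rewrite -[X in eqmodX _ _ X]mulr1; apply: eqmodXM.
Qed.

Lemma sinh2_polyN N a : sinh2_poly N (- a) = - sinh2_poly N a.
Proof. by rewrite /sinh2_poly scaleNr opprK opprB. Qed.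

(** 2 sinh(aX) is X times a series with invertible constant term 2a; cancelling X costs the one
    order. *)
Lemma sinh2_cancel N a (p q : {poly F}) : a != 0 ->
  eqmodX N.+1 (sinh2_poly N.+1 a * p) (sinh2_poly N.+1 a * q) -> eqmodX N p q.
Proof.
move=> a0; case: N => [//|N].
have S0 : (sinh2_poly N.+2 a)`_0 = 0.
  by rewrite coefB -scaleNr !coef_exppX// subrr.
have S1 : (sinh2_poly N.+2 a)`_1 != 0.
  rewrite coefB -scaleNr !coef_exppX// !expr1 !divr1 opprK -mulr2n.
  by rewrite mulrn_eq0 (negPf a0).
case/coef0_mulX: S0 => s Ss; rewrite Ss -!mulrA => /eqmodX_mulX.
by apply: eqmodX_cancel; rewrite Ss coefXM in S1.
Qed.

(** X / sinh X is even: replacing a = 1 by a = -1 changes the sign of both 2 sinh(aX) and 2aX, so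
    the quotient is the same. No vanishing of odd Bernoulli numbers is invoked; at i = 1 the factor
    2 - 2^i does the work. *)
Lemma csch_poly_odd N i : (i < N)%N -> odd i -> (csch_poly N.+1 1)`_i = 0 :> F.
Proof.
move=> iN oi; have := @csch_poly_mul N.+1 (-1); rewrite sinh2_polyN.
move=> /eqmodXN; rewrite mulNr opprK -scaleNr mulrN opprK => h.
have h' := @sinh2_cancel N _ _ _ (oner_neq0 F)
  (eqmodX_trans (@csch_poly_mul N.+1 1) (eqmodX_sym h)).
have := h' i iN; rewrite !coef_csch_poly ?ltnS ?(ltnW iN)//.
rewrite -[(-1) ^+ i]signr_odd oi expr1 expr1n mulrN1 mulNr mulr1 => /eqP.
by rewrite -addr_eq0 -mulr2n mulrn_eq0 /= => /eqP.
Qed.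

Lemma csch_solution N (H E : {poly F}) :
  eqmodX N.+1 (2 *: 'X * (1 + 2 *: (sinh2_poly N.+1 1 * H)))
              (sinh2_poly N.+1 1 * E) ->
  eqmodX N E (csch_poly N.+1 1 + 4 *: ('X * H)).
Proof.
move=> h; apply: (@sinh2_cancel N 1); first exact: oner_neq0.
apply: eqmodX_trans (eqmodX_sym h) _; apply: eqmodX_sym.
rewrite (_ : 2 *: 'X * _ = (2 * 1) *: 'X + sinh2_poly N.+1 1 * (4 *: ('X * H))).
  by rewrite mulrDr; apply: eqmodXD => //; exact: csch_poly_mul.
by rewrite mulr1 -!mul_polyC; ring.
Qed.

(** * The two formulas as coefficient comparisons for E = exp U *)

Section Recurrence.
Variables (phi gam : nat -> F).
Variable n : nat.
Let u : {poly F} := \poly_(j < n.+2) (if j == 0%N then 0 else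
  2 * (phi j * 2 ^+ j / j`!%:R)).
Hypothesis hE : forall i, (0 < i <= n.+1)%N ->
  (expp n.+2 u)`_i = 4 * gam i / i.-1`!%:R.
Hypothesis gam1 : gam 1%N = 0.

Let u0 : u`_0 = 0. Proof. by rewrite coef_poly. Qed.

Let uS i : (i < n.+1)%N -> u`_i.+1 *+ i.+1 =
  2 * (phi i.+1 * 2 ^+ i.+1 / i`!%:R).
Proof.
move=> iN; rewrite coef_poly ltnS iN /= -[LHS]mulr_natr factS natrM.
have := factnz F i; have : i.+1%:R != 0 :> F by rewrite pnatr_eq0.
by move=> i1 f0; field; rewrite f0 addrC natr1.
Qed.

(** The linear coefficient of E is that of U, and it vanishes with [gam 1]. This is why the
    recurrence can start at l = 2. *)
Let phi1 : phi 1%N = 0.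
Proof.
have := @hE 1%N isT; rewrite gam1 mulr0 mul0r => h.
have h2 := @expp_ode _ n.+1 _ u0 0%N isT.
move: h2; rewrite coef_deriv h mul0rn coefM big_ord1 expp_coef0// mulr1.
rewrite coef_deriv uS// fact0 divr1 expr1 => /esym/eqP.
rewrite mulf_eq0 pnatr_eq0 /= mulf_eq0 pnatr_eq0 orbF.
by move/eqP.
Qed.

(** The coefficient of X^n in E' = U' E, solved for the top coefficient of U', which is multiplied
    by E(0) = 1. *)
Lemma phi_recurrence :
  phi n.+1 = n.+1%:R * gam n.+1 / 2 ^+ n
    - \sum_(2 <= l < n.+1) 'C(n, l.-1)%:R * phi l *
        ((n.+1 - l)%N%:R * gam (n.+1 - l)%N / 2 ^ (n.+1%:Z - l%:Z - 2)).
Proof.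
have := @expp_ode _ n.+1 _ u0 n (ltnSn n).
rewrite coef_deriv hE ?leqnn// coefM big_ord_recr /= subnn expp_coef0// mulr1.
rewrite coef_deriv uS// => /eqP; rewrite addrC -subr_eq => /eqP h.
have fn := factnz F n.
have p2 m : 2 ^+ m != 0 :> F by rewrite expf_neq0// pnatr_eq0.
have -> : phi n.+1 = (2 * (phi n.+1 * 2 ^+ n.+1 / n`!%:R)) * (n`!%:R / 2 ^+ n.+2).
  by rewrite [2 ^+ n.+2]exprS; field; rewrite fn !p2.
rewrite -h mulrBl; congr (_ - _).
  rewrite -[4 * _ / _ *+ _]mulr_natr !exprS; field.
  by rewrite fn !p2.
transitivity (\sum_(1 <= l < n.+1) 'C(n, l.-1)%:R * phi l *
    ((n.+1 - l)%N%:R * gam (n.+1 - l)%N / 2 ^ (n.+1%:Z - l%:Z - 2))); last first.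
  have [->|n0] := posnP n; first by rewrite !big_geq.
  by rewrite [LHS]big_ltn// phi1 mulr0 mul0r add0r.
rewrite big_add1 /= big_mkord mulr_suml; apply: eq_bigr => i _.
have iN := ltn_ord i.
rewrite coef_deriv uS ?ltnS ?(ltnW iN)// subSS hE; last first.
  by rewrite subn_gt0 iN (leq_trans (leq_subr _ _)).
(* For i = n - 1 the exponent is -1, hence an integer power. *)
have -> : 2 ^ (n.+1%:Z - i.+1%:Z - 2) = 2 ^+ (n - i) / 4 :> F.
  rewrite (_ : _ - _ - _ = (n - i)%N%:Z + -2%:Z); last by lia.
  by rewrite expfzDr ?pnatr_eq0// -exprnN; congr (_ / _); rewrite -natrX.
rewrite -(bin_fact (ltnW iN)) !natrM.
have -> : 2 ^+ n.+2 = 4 * 2 ^+ i * 2 ^+ (n - i) :> F.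
  rewrite -mulrA -exprD subnKC ?(ltnW iN)// !exprS; ring.
have [m nim] : exists m, (n - i)%N = m.+1.
  by exists (n - i).-1; rewrite prednK// subn_gt0.
rewrite nim /= factS natrM exprS.
have m1 : m.+1%:R != 0 :> F by rewrite pnatr_eq0.
by field; rewrite !factnz !p2 ?pnatr_eq0//= addrC natr1.
Qed.

(** The coefficient of X^n in U' = E' exp(-U); [tr m] stands for the coefficient of (2X)^m in
    exp(-U). *)
Lemma phi_trace (tr : nat -> F) :
  (forall m, (m <= n)%N -> tr m * 2 ^+ m = (expp n.+2 (- u))`_m) ->
  phi n.+1 = \sum_(2 <= l < n.+2) l%:R * gam l / 2 ^+ l.-1
      * (n`!%:R / (l.-1)`!%:R) * tr (n.+1 - l)%N.
Proof.
move=> htr.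
have : eqmodX n.+1 ((expp n.+2 u)^`() * expp n.+2 (- u)) u^`().
  apply: (@eqmodX_trans _ _ ((u^`() * expp n.+2 u) * expp n.+2 (- u))).
    by apply: eqmodXM => //; apply: expp_ode.
  rewrite -mulrA -[X in eqmodX _ _ X](mulr1 u^`()).
  by apply: eqmodXM => //; exact: eqmodX_leq (leqnSn n.+1) (@exppN _ n.+2 _ u0).
move/(_ n (ltnSn n)); rewrite coef_deriv uS// coefM => h.
have fn := factnz F n.
have p2 m : 2 ^+ m != 0 :> F by rewrite expf_neq0// pnatr_eq0.
have -> : phi n.+1 = (2 * (phi n.+1 * 2 ^+ n.+1 / n`!%:R)) * (n`!%:R / 2 ^+ n.+2).
  by rewrite [2 ^+ n.+2]exprS; field; rewrite fn !p2.
rewrite -h.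
transitivity (\sum_(1 <= l < n.+2) l%:R * gam l / 2 ^+ l.-1
      * (n`!%:R / (l.-1)`!%:R) * tr (n.+1 - l)%N); last first.
  by rewrite [LHS]big_ltn// gam1 mulr0 !mul0r add0r.
rewrite big_add1 /= big_mkord mulr_suml; apply: eq_bigr => i _.
have iN : (i <= n)%N by rewrite -ltnS.
rewrite subSS coef_deriv hE ?ltn_ord//= -htr ?leq_subr//.
have -> : 2 ^+ n.+2 = 4 * 2 ^+ i * 2 ^+ (n - i) :> F.
  rewrite -mulrA -exprD subnKC// !exprS; ring.
rewrite -[4 * _ / _ *+ _]mulr_natr.
by field; rewrite !factnz !p2.
Qed.

End Recurrence.
End Formal.

(** * Traces over partitions as coefficients of exp(-U) *)

Section Trace.
Variable R : realType.
Variables (f : nat -> R[i] -> R[i]) (tau : R[i]).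

(** The exponential of a sum of monomials c_i X^(i+1) is the product of their exponentials.
    Expanding it, a choice of exponents lam contributes to X^m exactly when lam is a partition of m.
    The sign in [psi] is that of -U, and 2^m collects the powers 2^j attached to the f_j. *)
Lemma trace_coef n m : (m < n)%N ->
  Tr m psi f tau * 2 ^+ m = (expp n (- \poly_(j < n) (if j == 0%N then 0 else
     2 * (f j tau * 2 ^+ j / j`!%:R))))`_m.
Proof.
move=> mn; set u := \poly_(j < n) _.
pose c (i : nat) : R[i] := - (2 * (f i.+1 tau * 2 ^+ i.+1 / i.+1`!%:R)).
pose v : {poly R[i]} := \sum_(i < m) c i *: 'X^(i.+1).
have u0 : (- u)`_0 = 0 by rewrite coefN coef_poly (leq_ltn_trans _ mn)// oppr0.
have uv : eqmodX m.+1 (- u) v.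
  move=> j jm; rewrite coefN coef_poly (leq_trans jm mn) coef_sum.
  case: j jm => [|j] jm.
    by rewrite oppr0 big1// => i _; rewrite coefZ coefXn mulr0.
  rewrite (bigD1 (Ordinal (jm : (j < m)%N)))//= big1 ?addr0.
    by rewrite coefZ coefXn eqxx mulr1.
  move=> i; rewrite -val_eqE /= => ij; rewrite coefZ coefXn eqSS eq_sym.
  by rewrite (negPf ij) mulr0.
(* Parts and multiplicities above m cannot reach X^m; dropping them leaves precisely the index type
   [multiplicities m]. *)
rewrite (expp_leq u0 mn) ?ltnS// (expp_eqmodX uv) ?ltnS//.
rewrite (@expp_sum _ m.+1 _ _ (fun i : 'I_m => c i *: 'X^(i.+1))) ?ltnS//; last first.
  by move=> i; rewrite coefZ coefXn mulr0.
rewrite /expp bigA_distr_bigA /= coef_sum /Tr mulr_suml.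
rewrite [LHS]big_mkcond; apply: eq_bigr => lam _ /=.
have -> : \prod_(i < m) ((lam i)`!%:R^-1 *: (c i *: 'X^(i.+1)) ^+ lam i) =
   (\prod_(i < m) (c i ^+ lam i / (lam i)`!%:R)) *:
     'X^(\sum_(i < m) i.+1 * lam i) :> {poly R[i]}.
  rewrite -prodrXr -scaler_prod; apply: eq_bigr => i _.
  by rewrite exprZn scalerA mulrC exprM.
rewrite coefZ coefXn /is_partition eq_sym.
case: eqP => [hm|_]; last by rewrite mulr0.
rewrite mulr1 /psi /phi /f_partition (congr1 (GRing.exp 2) hm) -!prodrXr.
rewrite -!big_split /=.
apply: eq_bigr => i _; rewrite /c exprM.
rewrite -[- (2 * _)]mulN1r !exprMn exprVn.
by field; rewrite expf_neq0 ?factnz.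
Qed.

End Trace.

(** * Real-valued modulus and limits of complex sequences *)

Section Modulus.
Variable R : realType.
Local Notation C := R[i].
Implicit Types z w : C.

(** The norm of [R[i]] takes values in [R[i]]; a modulus in [R] gives access to a total order, to
    suprema and to [lra]. *)
Definition modulus z : R := Normc.normc z.

Lemma modulus_ge0 z : 0 <= modulus z.
Proof. by case: z => a b; exact: sqrtr_ge0. Qed.

Lemma modulus0 : modulus 0 = 0. Proof. exact: Normc.normc0. Qed.
Lemma modulus1 : modulus 1 = 1. Proof. exact: Normc.normc1. Qed.

Lemma modulus_eq0 z : (modulus z == 0) = (z == 0).
Proof.
by apply/eqP/eqP => [/Normc.eq0_normc//|->]; exact: modulus0.
Qed.

Lemma modulus_gt0 z : (0 < modulus z) = (z != 0).
Proof. by rewrite lt_def modulus_ge0 andbT modulus_eq0. Qed.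

Lemma modulusM z w : modulus (z * w) = modulus z * modulus w.
Proof. exact: Normc.normcM. Qed.

Lemma modulusV z : modulus z^-1 = (modulus z)^-1.
Proof. exact: Normc.normcV. Qed.

Lemma modulusN z : modulus (- z) = modulus z.
Proof. exact: normcN. Qed.

Lemma modulusX z n : modulus (z ^+ n) = modulus z ^+ n.
Proof.
by elim: n => [|n ih]; rewrite ?expr0 ?modulus1// !exprS modulusM ih.
Qed.

Lemma modulusD z w : modulus (z + w) <= modulus z + modulus w.
Proof. exact: le_normcD. Qed.

Lemma modulusB z w : modulus (z - w) <= modulus z + modulus w.
Proof. by rewrite -(modulusN w) modulusD. Qed.

Lemma modulus_distC z w : modulus (z - w) = modulus (w - z).
Proof. by rewrite -modulusN opprB. Qed.

Lemma modulus_triangle z w v : modulus (z - v) <= modulus (z - w) + modulus (w - v).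
Proof. by rewrite -[z - v](subrKA w) modulusD. Qed.

Lemma modulus_sum (I : Type) (s : seq I) (P : pred I) (F : I -> C) :
  modulus (\sum_(i <- s | P i) F i) <= \sum_(i <- s | P i) modulus (F i).
Proof.
elim/big_ind2 : _ => //; first by rewrite modulus0.
by move=> z r w t hz hw; apply: le_trans (modulusD _ _) _; exact: lerD.
Qed.

Lemma modulus_prod (I : Type) (s : seq I) (P : pred I) (F : I -> C) :
  modulus (\prod_(i <- s | P i) F i) = \prod_(i <- s | P i) modulus (F i).
Proof. by apply: (big_morph modulus modulusM modulus1). Qed.

Lemma modulus_real (x : R) : modulus x%:C%C = `|x|.
Proof. by rewrite /modulus /= expr0n addr0 sqrtr_sqr. Qed.

Lemma modulus_nat n : modulus n%:R = n%:R.
Proof.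
have -> : n%:R = (n%:R : R)%:C%C :> C by rewrite rmorph_nat.
by rewrite modulus_real ger0_norm.
Qed.

Lemma modulus_ge_dist z w : modulus z - modulus w <= modulus (z - w).
Proof. by rewrite lerBlDr -{1}(subrK w z) modulusD. Qed.

Lemma modulus_ge_Re z : `|complex.Re z| <= modulus z.
Proof.
case: z => a b /=; rewrite -sqrtr_sqr ler_sqrt ?addr_ge0 ?sqr_ge0//.
by rewrite lerDl sqr_ge0.
Qed.

Lemma modulus_ge_Im z : `|complex.Im z| <= modulus z.
Proof.
case: z => a b /=; rewrite -sqrtr_sqr ler_sqrt ?addr_ge0 ?sqr_ge0//.
by rewrite lerDr sqr_ge0.
Qed.

Lemma modulus_eq z w : (forall e : R, 0 < e -> modulus (z - w) < e) -> z = w.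
Proof.
move=> h; apply/eqP; rewrite -subr_eq0 -modulus_eq0 eq_le modulus_ge0 andbT.
by apply/ler_addgt0Pl => e e0; rewrite addr0 ltW// h.
Qed.

Definition clim (u : nat -> C) (s : C) := forall e : R, 0 < e ->
  exists M, forall n, (M <= n)%N -> modulus (u n - s) < e.

Lemma clim_uniq u s t : clim u s -> clim u t -> s = t.
Proof.
move=> hs ht; apply: modulus_eq => e e0.
have e2 : 0 < e / 2 by rewrite divr_gt0.
have [M hM] := hs _ e2; have [N hN] := ht _ e2.
have := hM _ (leq_maxl M N); have := hN _ (leq_maxr M N).
set n := maxn M N => h1 h2.
apply: le_lt_trans (modulus_triangle _ (u n) _) _.
by rewrite (modulus_distC s); lra.
Qed.

Lemma clim_ext u v s : (forall n, u n = v n) -> clim u s -> clim v s.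
Proof. by move=> uv h e /h[M hM]; exists M => n /hM; rewrite uv. Qed.

Lemma clim_shift u s k : clim u s -> clim (fun n => u (n + k)%N) s.
Proof.
move=> h e /h[M hM]; exists M => n Mn; apply: hM.
exact: leq_trans Mn (leq_addr _ _).
Qed.

Lemma clim_cst s : clim (fun=> s) s.
Proof. by move=> e e0; exists 0%N => n _; rewrite subrr modulus0. Qed.

Lemma climD u v s t : clim u s -> clim v t -> clim (fun n => u n + v n) (s + t).
Proof.
move=> hs ht e e0; have e2 : 0 < e / 2 by rewrite divr_gt0.
have [M hM] := hs _ e2; have [N hN] := ht _ e2.
exists (maxn M N) => n; rewrite geq_max => /andP[/hM h1 /hN h2].
rewrite opprD addrACA; apply: le_lt_trans (modulusD _ _) _; lra.
Qed.

Lemma climZ c u s : clim u s -> clim (fun n => c * u n) (c * s).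
Proof.
move=> hs e e0; have c0 := modulus_ge0 c.
have c1 : 0 < modulus c + 1 by lra.
have [M hM] := hs (e / (modulus c + 1)) (divr_gt0 e0 c1).
exists M => n /hM; rewrite -mulrBr modulusM ltr_pdivlMr// => h.
apply: le_lt_trans h; rewrite mulrC ler_wpM2l ?modulus_ge0//; lra.
Qed.

Lemma clim_le u s (K : R) : clim u s -> (forall n, modulus (u n) <= K) -> modulus s <= K.
Proof.
move=> hs hK; apply/ler_addgt0Pl => e e0; have [M hM] := hs _ e0.
have := hM M (leqnn _); have := hK M; have := modulus_ge_dist s (u M).
rewrite modulus_distC; lra.
Qed.

Lemma clim_dist u s t (K : R) : clim u s ->
  (forall n, modulus (u n - t) <= K) -> modulus (s - t) <= K.
Proof.
move=> hs hK; apply: (@clim_le (fun n => u n - t)) => //.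
exact: climD hs (clim_cst _).
Qed.

Lemma climM u v s t : clim u s -> clim v t -> clim (fun n => u n * v n) (s * t).
Proof.
move=> hs ht e e0.
have s0 := modulus_ge0 s; have t0 := modulus_ge0 t.
pose K := modulus s + modulus t + 2.
have K0 : 0 < K by rewrite /K; lra.
have d0 : 0 < Num.min 1 (e / K) by rewrite lt_min ltr01 divr_gt0.
have [M hM] := hs _ d0; have [N hN] := ht _ d0.
exists (maxn M N) => n; rewrite geq_max => /andP[/hM h1 /hN h2].
move: h1 h2; rewrite !lt_min => /andP[a1 a2] /andP[b1 b2].
rewrite (_ : _ - _ = (u n - s) * (v n - t) + s * (v n - t) + t * (u n - s)); last by ring.
apply: le_lt_trans (modulusD _ _) _; rewrite [modulus (t * _)]modulusM.
apply: le_lt_trans (lerD (modulusD _ _) (lexx _)) _; rewrite !modulusM.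
move: a1 a2 b1 b2; have := modulus_ge0 (u n - s); have := modulus_ge0 (v n - t).
move: (modulus (u n - s)) (modulus (v n - t)) => x y x0 y0.
rewrite !ltr_pdivlMr// /K; nra.
Qed.

Lemma climV u s : s != 0 -> clim u s -> clim (fun n => (u n)^-1) s^-1.
Proof.
move=> s0 hs e e0; have m0 : 0 < modulus s by rewrite modulus_gt0.
pose m := modulus s.
have d0 : 0 < Num.min (m / 2) (e * m ^+ 2 / 2).
  by rewrite lt_min !divr_gt0// mulr_gt0// exprn_gt0.
have [M hM] := hs _ d0; exists M => n /hM; rewrite lt_min => /andP[a b].
have h : m / 2 <= modulus (u n).
  have := modulus_ge_dist s (u n); rewrite modulus_distC -/m; lra.
have un0 : u n != 0 by rewrite -modulus_gt0; apply: lt_le_trans h; rewrite divr_gt0.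
rewrite (_ : _ - _ = (s - u n) / (u n * s)); last by field; rewrite un0 s0.
rewrite modulusM modulusV modulusM modulus_distC -/m.
rewrite ltr_pdivrMr ?mulr_gt0 ?modulus_gt0//.
apply: lt_le_trans b _.
rewrite -mulrA ler_wpM2l ?(ltW e0)// expr2 mulrAC.
by rewrite ler_wpM2r// ltW.
Qed.

Lemma clim_geometric u s (rho : R) : 0 <= rho < 1 ->
  (exists K, forall n, modulus (u n - s) <= K * rho ^+ n) -> clim u s.
Proof.
move=> /andP[r0 r1] [K hK] e e0.
have := cvg_expr (_ : `|rho| < 1); rewrite ger0_norm// => /(_ r1).
have K1 : 0 < `|K| + 1 by rewrite ltr_wpDl.
move=> /cvgrPdist_lt /(_ (e / (`|K| + 1)) (divr_gt0 e0 K1)) [M _ hM].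
exists M => n Mn; apply: le_lt_trans (hK n) _.
have := hM n Mn; rewrite sub0r normrN ger0_norm ?exprn_ge0// ltr_pdivlMr// => h.
apply: le_lt_trans h; rewrite mulrC ler_wpM2l ?exprn_ge0//.
by apply: le_trans (ler_norm _) _; rewrite lerDl.
Qed.

End Modulus.

(** * Unordered sums, absolute convergence and Tannery's theorem *)

Section UnorderedSums.
Local Open Scope classical_set_scope.
Local Open Scope ring_scope.
Variable R : realType.
Local Notation C := R[i].

(** The limit behind [sum_over], stated with the real modulus; [sum_overE] translates back. *)
Definition hsum (I : choiceType) (F : I -> C) (s : C) := forall e : R, 0 < e ->
  exists A : {fset I}, forall B : {fset I}, (A `<=` B)%fset ->
    modulus (\sum_(i <- B) F i - s) < e.

Definition abs_bounded (I : choiceType) (F : I -> C) (K : R) :=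
  forall A : {fset I}, \sum_(i <- A) modulus (F i) <= K.

(** A positive element of [R[i]] has zero imaginary part, so balls of complex radius are balls for
    [modulus]. *)
Lemma nbhs_ball_modulus (s : C) (U : set C) :
  nbhs s U <-> exists2 e : R, 0 < e & forall z, modulus (z - s) < e -> U z.
Proof.
split=> [/nbhs_ballP[e /= e0 he]|[e e0 he]].
  have := e0; rewrite ltcE /= => /andP[/eqP ei er].
  exists (complex.Re e) => // z hz; apply: he.
  rewrite -ball_normE /= distrC; change ((modulus (z - s))%:C%C < e).
  by case: e ei er hz {e0} => a b /= -> _ hz; rewrite ltcR.
apply/nbhs_ballP; exists e%:C%C => /=; first by rewrite ltcR.
move=> z; rewrite -ball_normE /= distrC => h; apply: he; rewrite -ltcR.
exact: h.
Qed.

Lemma sum_overE (I : choiceType) (P : pred I) (F : I -> C) s :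
  hsum (fun i => if P i then F i else 0) s -> sum_over P F = s.
Proof.
move=> h; rewrite /sum_over /summability.sum.
apply: cvg_lim; [exact: norm_hausdorff|exact: totally_filter|].
move=> U /nbhs_ball_modulus[d d0 hd].
have [A hA] := h d d0.
exists A => // B /= AB; apply: hd.
rewrite /partial_sum -(big_seq_fsetE _ _ xpredT (fun i => if P i then F i else 0)).
exact: hA.
Qed.

Lemma lim_clim (u : nat -> C) s : clim u s -> lim (u n @[n --> \oo]) = s.
Proof.
move=> h; apply: cvg_lim; first exact: norm_hausdorff.
move=> U /nbhs_ball_modulus[d d0 hd].
by have [M hM] := h d d0; exists M => // n /= /hM /hd.
Qed.

Lemma cvg_clim (u : nat -> C) : cvg (u n @[n --> \oo]) ->
  clim u (lim (u n @[n --> \oo])).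
Proof.
move=> h e e0; set s := lim _.
have : nbhs s [set z | modulus (z - s) < e].
  by apply/nbhs_ball_modulus; exists e.
by move/h => [M _ hM]; exists M => n Mn; exact: hM.
Qed.

Section Basic.
Variable I : choiceType.
Implicit Types (F G : I -> C).

Lemma hsum_ext F G s : F =1 G -> hsum F s -> hsum G s.
Proof. by move=> FG h e /h[A hA]; exists A => B /hA; rewrite (eq_bigr G). Qed.

Lemma hsumD F G s t : hsum F s -> hsum G t -> hsum (fun i => F i + G i) (s + t).
Proof.
move=> hs ht e e0; have e2 : 0 < e / 2 by rewrite divr_gt0.
have [A hA] := hs _ e2; have [B hB] := ht _ e2.
exists (A `|` B)%fset => D; rewrite fsubUset => /andP[/hA h1 /hB h2].
rewrite big_split /= opprD addrACA; apply: le_lt_trans (modulusD _ _) _; lra.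
Qed.

Lemma hsumZ c F s : hsum F s -> hsum (fun i => c * F i) (c * s).
Proof.
move=> hs e e0; have c0 := modulus_ge0 c.
have c1 : 0 < modulus c + 1 by lra.
have [A hA] := hs (e / (modulus c + 1)) (divr_gt0 e0 c1).
exists A => B /hA; rewrite -mulr_sumr -mulrBr modulusM ltr_pdivlMr// => h.
apply: le_lt_trans h; rewrite mulrC ler_wpM2l ?modulus_ge0//; lra.
Qed.

Lemma hsumB F G s t : hsum F s -> hsum G t -> hsum (fun i => F i - G i) (s - t).
Proof.
move=> hs /(hsumZ (-1)) ht; rewrite -mulN1r.
by apply: hsum_ext (hsumD hs ht) => i; rewrite mulN1r.
Qed.

Lemma hsum_sum (J : Type) (r : seq J) (F : J -> I -> C) (s : J -> C) :
  (forall j, hsum (F j) (s j)) ->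
  hsum (fun i => \sum_(j <- r) F j i) (\sum_(j <- r) s j).
Proof.
move=> h; elim: r => [|j r ih].
  rewrite big_nil => e e0; exists fset0 => B _.
  by rewrite big1 ?subrr ?modulus0// => i _; rewrite big_nil.
by rewrite big_cons; apply: hsum_ext (hsumD (h j) ih) => i; rewrite big_cons.
Qed.

Lemma hsum_uniq F s t : hsum F s -> hsum F t -> s = t.
Proof.
move=> hs ht; apply: modulus_eq => e e0.
have e2 : 0 < e / 2 by rewrite divr_gt0.
have [A hA] := hs _ e2; have [B hB] := ht _ e2.
have := hA _ (fsubsetUl A B); have := hB _ (fsubsetUr A B).
set n := \sum_(i <- _) _ => h1 h2.
by apply: le_lt_trans (modulus_triangle _ n _) _; rewrite (modulus_distC s); lra.
Qed.

Lemma hsum_le F s K : hsum F s -> abs_bounded F K -> modulus s <= K.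
Proof.
move=> hs hK; apply/ler_addgt0Pl => e e0; have [A hA] := hs _ e0.
have := hA A (fsubset_refl A); set t := \sum_(i <- _) _ => h.
have : modulus t <= K by apply: le_trans (modulus_sum _ _ _) (hK A).
by have := modulus_ge_dist s t; rewrite modulus_distC; lra.
Qed.

Lemma hsum_pos (x : I -> R) K : (forall i, 0 <= x i) ->
  (forall A : {fset I}, \sum_(i <- A) x i <= K) ->
  exists s : R, hsum (fun i => (x i)%:C%C) s%:C%C.
Proof.
move=> x0 hK; pose S := [set \sum_(i <- A) x i | A in @setT {fset I}]%classic.
have Sne : S !=set0 by exists (\sum_(i <- fset0) x i), fset0.
have Sub : ubound S K by move=> _ [A _ <-]; exact: hK.
have hS : has_sup S by split => //; exists K.
exists (sup S) => e e0.
have [_ [A _ <-] hA] := sup_adherent e0 hS.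
exists A => B AB.
have -> : \sum_(i <- B) (x i)%:C%C - (sup S)%:C%C =
  (\sum_(i <- B) x i - sup S)%:C%C :> C by rewrite rmorphB rmorph_sum.
rewrite modulus_real.
have h1 : \sum_(i <- B) x i <= sup S by apply: ub_le_sup; [exists K|exists B].
have h2 : \sum_(i <- A) x i <= \sum_(i <- B) x i.
  rewrite (big_fsetID _ (mem A) B) /=.
  have -> : [fset i in B | i \in A]%fset = A.
    apply/fsetP => i; rewrite !inE /=; case: (boolP (i \in A)) => [iA|]; rewrite ?andbF//.
    by rewrite (fsubsetP AB).
  by rewrite lerDl sumr_ge0.
by rewrite distrC ger0_norm ?subr_ge0//; lra.
Qed.

Lemma hsum_ex F K : abs_bounded F K -> exists s, hsum F s.
Proof.
move=> hK.
have [a ha] : exists s : R, hsum (fun i => (modulus (F i))%:C%C) s%:C%C.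
  exact: hsum_pos (fun i => modulus_ge0 (F i)) hK.
have bound (h : C -> R) : (forall z, `|h z| <= modulus z) ->
    exists s : C, hsum (fun i => (h (F i))%:C%C) s.
  move=> hh.
  (* Adding the modulus makes the terms nonnegative and at most 2|F|, so the supremum argument of
     [hsum_pos] applies; the sum of the moduli is subtracted afterwards. *)
  have [s hs] : exists s : R, hsum (fun i => (h (F i) + modulus (F i))%:C%C) s%:C%C.
    apply: (@hsum_pos _ (2 * K)) => [i|A].
      by have := hh (F i); rewrite ler_norml => /andP[]; lra.
    apply: le_trans (_ : \sum_(i <- A) 2 * modulus (F i) <= _).
      apply: ler_sum => i _; have := hh (F i); rewrite ler_norml => /andP[]; lra.
    by rewrite -mulr_sumr ler_pM2l//; exact: hK.
  exists (s%:C%C - a%:C%C); apply: hsum_ext (hsumB hs ha) => i.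
  by rewrite rmorphD /= addrK.
have [s hs] := bound _ (@modulus_ge_Re R).
have [t ht] := bound _ (@modulus_ge_Im R).
exists (s + 'i%C * t); apply: hsum_ext (hsumD hs (hsumZ 'i%C ht)) => i.
by rewrite [RHS]complexE.
Qed.

Lemma hsum_exhaust F s (A : nat -> seq I) : hsum F s ->
  (forall M, uniq (A M)) ->
  (forall i, exists M0, forall M, (M0 <= M)%N -> i \in A M) ->
  clim (fun M => \sum_(i <- A M) F i) s.
Proof.
move=> hs uA exA e /hs[B hB].
have [M0 hM0] : exists M0, forall M, (M0 <= M)%N -> {subset enum_fset B <= A M}.
  elim: (enum_fset B) => [|i r [M0 ih]]; first by exists 0%N => M _ i.
  have [M1 hM1] := exA i; exists (maxn M0 M1) => M.
  rewrite geq_max => /andP[/ih h /hM1 h1] j; rewrite inE => /predU1P[->//|].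
  exact: h.
exists M0 => M /hM0 BA.
have := hB [fset i in A M]%fset; rewrite (perm_big (A M)) /=; last first.
  by apply: uniq_perm => //= i; rewrite in_fset.
by apply; apply/fsubsetP => i iB; rewrite in_fset BA.
Qed.

End Basic.

Lemma hsum_inj (I J : choiceType) (h : J -> I) (F : I -> C) s :
  injective h -> (forall i, (forall j, i <> h j) -> F i = 0) ->
  hsum (F \o h) s -> hsum F s.
Proof.
move=> hinj F0 hs e /hs[A hA]; exists (h @` A)%fset => B AB.
(* A partial inverse of h obtained by choice; [pmap g] pulls a finite set of indices back to J. *)
pose g i : option J := if pselect (exists j, h j = i) is left w
  then Some (projT1 (cid w)) else None.
have gh : ocancel g h.
  by rewrite /g => i; case: pselect => //= w; case: (cid w).
have hg j : g (h j) = Some j.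
  rewrite /g; case: pselect => [w|[]]; last by exists j.
  by congr Some; case: (cid w) => /= j' /hinj.
have sumE s' : \sum_(j <- pmap g s') F (h j) = \sum_(i <- s') F i.
  elim: s' => [|i s' ih]; first by rewrite !big_nil.
  rewrite big_cons -ih /=; have := gh i; case E: (g i) => [j|] /= hj.
    by rewrite big_cons hj.
  by rewrite F0 ?add0r// => j ij; move: E; rewrite ij hg.
have := hA [fset j in pmap g B]%fset; rewrite (perm_big (pmap g B)) /=; last first.
  apply: uniq_perm => [|//=|j]; rewrite ?in_fset//.
  exact: pmap_uniq gh _ (fset_uniq _).
rewrite sumE; apply; apply/fsubsetP => j jA; rewrite in_fset /= mem_pmap -hg.
by apply/map_f/(fsubsetP AB); rewrite in_imfset.
Qed.

(** Dominated convergence along the diagonal: M is both the parameter and the number of terms. The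
    limit series and the finite head each take e/4, and the tail, at most twice that of b, takes
    e/2. *)
Lemma tannery (u : nat -> nat -> C) (v : nat -> C) (b : nat -> R) (K : R) (S : C) :
  (forall n, \sum_(r < n) b r <= K) ->
  (forall r M, modulus (u r M) <= b r) ->
  (forall r, clim (u r) (v r)) ->
  clim (fun M => \sum_(r < M) v r) S ->
  clim (fun M => \sum_(r < M) u r M) S.
Proof.
move=> hK ub uv hS e e0.
have b0 r : 0 <= b r by apply: le_trans (ub r 0%N); exact: modulus_ge0.
have e4 : 0 < e / 4 by rewrite divr_gt0.
have vb r : modulus (v r) <= b r by apply: clim_le (uv r) _.
pose T := [set \sum_(r < n) b r | n in @setT nat]%classic.
have hT : has_sup T.
  by split; [exists (\sum_(r < 0) b r), 0%N|exists K => _ [n _ <-]].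
have [_ [N _ <-] hN] := sup_adherent e4 hT.
have tail M : (N <= M)%N -> \sum_(N <= r < M) b r < e / 4.
  move=> NM; have : \sum_(r < M) b r <= sup T by apply: ub_le_sup; [case: hT|exists M].
  rewrite -!(big_mkord xpredT) /= in hN *; rewrite (big_cat_nat (n := N))//=.
  lra.
have hN1 : clim (fun M => \sum_(r < N) (u r M - v r)) 0.
  elim: N {hN tail} => [|N ih].
    by apply: clim_ext (clim_cst 0) => M; rewrite big_ord0.
  have := climD ih (climD (uv N) (clim_cst (- v N))); rewrite subrr addr0.
  by apply: clim_ext => M; rewrite big_ord_recr.
have [M1 hM1] := hN1 _ e4; have [M2 hM2] := hS _ e4.
exists (maxn N (maxn M1 M2)) => M; rewrite !geq_max => /and3P[NM /hM1 h1 /hM2 h2].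
have -> : \sum_(r < M) u r M - S = (\sum_(r < M) v r - S) +
    (\sum_(r < N) (u r M - v r) - 0) + \sum_(N <= r < M) (u r M - v r).
  rewrite subr0 -addrA -(big_mkord xpredT (fun r => u r M - v r)).
  rewrite -big_cat_nat//= big_mkord sumrB; ring.
apply: le_lt_trans (modulusD _ _) _.
apply: le_lt_trans (lerD (modulusD _ _) (modulus_sum _ _ _)) _.
have : \sum_(N <= r < M) modulus (u r M - v r) <= 2 * \sum_(N <= r < M) b r.
  rewrite mulr_sumr; apply: ler_sum => r _.
  apply: le_trans (modulusB _ _) _; have := ub r M; have := vb r; lra.
by have := tail _ NM; lra.
Qed.

End UnorderedSums.

(** * The finite Bailey chain *)

Lemma telescope_step (F : fieldType) (q x y p0 p1 w : F) :
  1 - x * y * q != 0 -> 1 - y * q != 0 -> 1 - x ^+ 2 * y * q ^+ 3 != 0 ->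
  p0 != 0 -> p1 != 0 ->
  - (y * q * w) * (1 - x) * (1 - q * x) / ((1 - x * y * q) * (p0 * (1 - y * q)) * p1)
  + y * q * (w * (1 - q * x) * (1 - (q * x) ^+ 2)) /
      ((p0 * (1 - y * q)) * (p1 * (1 - x ^+ 2 * y * q ^+ 3)))
  = y * (w * (q * x)) * (1 - q * x) * (1 - q ^+ 2 * x) /
      ((1 - x * y * q) * p0 * (p1 * (1 - x ^+ 2 * y * q ^+ 3))).
Proof. by move=> h1 h2 h3 h4 h5; field; rewrite h1 h2 h3 h4 h5. Qed.

Section BaileyChain.
Variable R : realType.
Local Notation C := R[i].

Lemma qpochS (a q : C) n : qpoch a q n.+1 = qpoch a q n * (1 - a * q ^+ n).
Proof. by rewrite /qpoch big_ord_recr. Qed.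

Lemma qpoch0 (a q : C) : qpoch a q 0 = 1.
Proof. by rewrite /qpoch big_ord0. Qed.

Variable q : C.
Hypothesis qroot : forall n, q ^+ n.+1 != 1.

Local Notation P := (qpoch q q).

Lemma qq_pochS n : P n.+1 = P n * (1 - q ^+ n.+1).
Proof. by rewrite qpochS -exprS. Qed.

Lemma subq_neq0 n : 1 - q ^+ n.+1 != 0.
Proof. by rewrite subr_eq0 eq_sym qroot. Qed.

Lemma qq_poch_neq0 n : P n != 0.
Proof.
elim: n => [|n ih]; first by rewrite qpoch0 oner_neq0.
by rewrite qq_pochS mulf_neq0 ?subq_neq0.
Qed.

(** Induction on N for all M, splitting 1 - q^(N+1) as (1 - q^(N+1-j)) + q^(N+1-j) (1 - q^j). The
    first part is the sum for (N, M); the second, after shifting j, is q^(N+M+1) times the sum for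
    (N, M+1). *)
Lemma q_vandermonde N M :
  \sum_(j < N.+1) q ^+ (j * (j + M)) / (P (N - j) * P j * P (j + M)) =
  (P N * P (N + M))^-1.
Proof.
elim: N M => [|N ih] M.
  by rewrite big_ord1 mul0n expr0 subnn add0n qpoch0 !mul1r.
apply: (mulfI (subq_neq0 N)).
transitivity (\sum_(j < N.+1) q ^+ (j * (j + M)) / (P (N - j) * P j * P (j + M))
  + q ^+ (N + M).+1 *
    \sum_(j < N.+1) q ^+ (j * (j + M.+1)) / (P (N - j) * P j * P (j + M.+1))).
  transitivity (\sum_(j < N.+2) ((1 - q ^+ (N.+1 - j)) *
      (q ^+ (j * (j + M)) / (P (N.+1 - j) * P j * P (j + M))))
    + \sum_(j < N.+2) (q ^+ (N.+1 - j) * (1 - q ^+ j) *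
      (q ^+ (j * (j + M)) / (P (N.+1 - j) * P j * P (j + M))))).
    rewrite mulr_sumr -big_split /=; apply: eq_bigr => j _.
    have jN : (j <= N.+1)%N by rewrite -ltnS.
    by rewrite -{1}(subnK jN) exprD; ring.
  congr (_ + _).
    rewrite big_ord_recr /= subnn expr0 subrr mul0r addr0.
    apply: eq_bigr => j _; have jN : (j <= N)%N by rewrite -ltnS.
    rewrite subSn// qq_pochS.
    by field; rewrite subq_neq0 !qq_poch_neq0.
  rewrite big_ord_recl /= expr0 subrr mulr0 mul0r add0r mulr_sumr.
  apply: eq_bigr => j _; have jN : (j <= N)%N by rewrite -ltnS.
  rewrite /bump /= add1n subSS qq_pochS addSnnS.
  have -> : q ^+ (j.+1 * (j + M.+1)) = q ^+ (j * (j + M.+1)) * q ^+ (j + M.+1).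
    by rewrite -exprD mulSn addnC.
  have -> : q ^+ (N + M).+1 = q ^+ (N - j) * q ^+ (j + M.+1).
    rewrite -exprD; congr (_ ^+ _).
    by rewrite addnA subnK// addnS.
  by field; rewrite subq_neq0 !qq_poch_neq0.
rewrite !ih addnS addSn !qq_pochS.
by field; rewrite !subq_neq0 !qq_poch_neq0.
Qed.

(** Put m = s + j in [q_vandermonde]: m^2 = s^2 + j(j + 2s). This is Bailey's lemma with both free
    parameters sent to infinity. *)
Lemma bailey_step s n : (s <= n)%N ->
  \sum_(m < n.+1 | (s <= m)%N) q ^+ (m ^ 2) / (P (n - m) * P (m - s) * P (m + s))
  = q ^+ (s ^ 2) / (P (n - s) * P (n + s)).
Proof.
move=> sn; have := q_vandermonde (n - s) (s + s).
rewrite addnA subnK// => <-.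
pose G (m : nat) := q ^+ (m ^ 2) / (P (n - m) * P (m - s) * P (m + s)).
rewrite -[LHS](big_geq_mkord s n.+1 xpredT G) -[X in \sum_(X <= _ < _) _]add0n.
rewrite big_addn subSn// big_mkord mulr_sumr /G.
apply: eq_bigr => j _.
have -> : (n - (j + s) = n - s - j)%N by rewrite addnC subnDA.
rewrite addnK addnA mulrA -exprD; congr (q ^+ _ / _).
by rewrite !expnS !expn0; ring.
Qed.

Variable zeta : C.
Local Notation D r := ((1 - zeta * q ^+ r) * (1 - zeta^-1 * q ^+ r)).
Hypothesis zeta0 : zeta != 0.
Hypothesis D_neq0 : forall r, D r.+1 != 0.

(** The numerator, free of zeta, of alpha_r for r >= 1 in the Bailey pair; alpha_0 = 0. *)
Definition rank_num (r : nat) : C :=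
  (-1) ^+ r.-1 * q ^+ 'C(r, 2) * (1 - q ^+ r) * (1 - q ^+ (2 * r)).
Definition rank_alpha (r : nat) : C := rank_num r / D r.

(** Closed form of the partial sums. It stops at s = N + 1, where [N.+1 - s] is still a genuine
    difference; [telescope_total] adds the last term, which is the opposite of this value. *)
Let telescope N s : (s <= N.+1)%N ->
  \sum_(i < s) q ^+ (N.+1 - i) * rank_num i.+1 / (P (N.+1 - i) * P (N.+2 + i.+1))
  = (-1) ^+ s.+1 * q ^+ (N.+1 - s + 'C(s.+1, 2)) * (1 - q ^+ s) * (1 - q ^+ s.+1) /
    ((1 - q ^+ N.+1) * P (N.+1 - s) * P (N.+2 + s)).
Proof.
elim: s => [|s ih] sN; first by rewrite big_ord0 expr0 subrr mulr0 !mul0r.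
rewrite big_ord_recr /= ih ?(ltnW sN)//.
have [e Ne] : exists e, N = (e + s)%N by exists (N - s)%N; rewrite subnK.
have -> : (N.+1 - s = e.+1)%N by lia.
have -> : (N.+1 - s.+1 = e)%N by lia.
(* Each power of q becomes a product of q, x = q^s and y = q^e with e = N - s, so that the induction
   step is a rational identity in free variables. *)
have h := @telescope_step _ q (q ^+ s) (q ^+ e) (P e) (P (N.+2 + s))
  ((-1) ^+ s * q ^+ 'C(s.+1, 2)).
have E1 : q ^+ s * q ^+ e * q = q ^+ N.+1 by rewrite Ne -!exprD -exprSr addnC.
have E2 : (q ^+ s) ^+ 2 * q ^+ e * q ^+ 3 = q ^+ (N.+2 + s).+1.
  by rewrite -exprM -!exprD Ne; congr (_ ^+ _); lia.
have E3 : q ^+ 2 * q ^+ s = q ^+ s.+2 by rewrite -exprD.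
rewrite E1 E2 E3 -!exprSr -!exprS -!qq_pochS in h.
rewrite /rank_num /= addnS [in 'C(s.+2, 2)]binS bin1.
apply: etrans (etrans (h _ _ _ _ _) _); rewrite ?subq_neq0 ?qq_poch_neq0//.
  rewrite [(2 * _)%N]mulnC exprM exprD !exprS; congr (_ / _ + _ / _); ring.
rewrite !exprD !exprS; congr (_ / _); ring.
Qed.

Let telescope_total N :
  \sum_(i < N.+2) q ^+ (N.+1 - i) * rank_num i.+1 /
    (P (N.+1 - i) * P (N.+2 + i.+1)) = 0.
Proof.
rewrite big_ord_recr /= telescope// subnn /rank_num /= add0n expr0.
rewrite mul2n -addnn.
have -> : (N.+2 + N.+2 = (N.+2 + N.+1).+1)%N by rewrite addnS.
rewrite (qq_pochS (N.+2 + N.+1)).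
have h1 := subq_neq0 N; have h2 := subq_neq0 (N.+2 + N.+1).
rewrite [(-1) ^+ N.+2]exprS.
by field; rewrite h1 h2 !qq_poch_neq0.
Qed.

(* With D r the denominator of rank_alpha r, D (n+1) equals
   q^(n+1-r) D r + (1 - q^(n+1-r)) (1 - q^(n+1+r)): multiplying the claim at
   n + 1 by D (n+1) gives the claim at n plus a sum free of zeta, which
   telescopes to 0. *)
Lemma rank_bailey_pair n : (0 < n)%N ->
  (qpoch (zeta * q) q n * qpoch (zeta^-1 * q) q n)^-1 =
  \sum_(i < n) rank_alpha i.+1 / (P (n - i.+1) * P (n + i.+1)).
Proof.
case: n => // n _; elim: n => [|N ih].
  rewrite big_ord1 subnn /rank_alpha /rank_num /= expr0 bin_small// expr0 !mul1r.
  rewrite !qpochS !qpoch0 !expr0 !mulr1 !mul1r expr1 -expr2.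
  have := D_neq0 0; rewrite expr1; move: (_ * (1 - zeta^-1 * q)) => d d0.
  have h1 := subq_neq0 1; have h2 := subq_neq0 0; rewrite expr1 in h2.
  by field; rewrite d0 h1 h2.
rewrite !(qpochS _ _ N.+1) -!mulrA -!exprS.
apply: (mulfI (D_neq0 N.+1)).
transitivity (\sum_(i < N.+2) q ^+ (N.+1 - i) * rank_num i.+1 /
    (P (N.+1 - i) * P (N.+2 + i.+1)) +
  \sum_(i < N.+1) rank_alpha i.+1 / (P (N.+1 - i.+1) * P (N.+1 + i.+1))).
  rewrite telescope_total add0r -ih.
  have := D_neq0 N.+1; rewrite mulf_eq0 negb_or => /andP[d1 d2].
  rewrite !invfM; set A := (qpoch _ _ _)^-1; set B := (qpoch _ _ _)^-1.
  move: d1 d2; move: (1 - _) (1 - zeta^-1 * _) => x y x0 y0.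
  by field; rewrite x0 y0.
have -> : \sum_(i < N.+1) rank_alpha i.+1 / (P (N.+1 - i.+1) * P (N.+1 + i.+1)) =
  \sum_(i < N.+2) (1 - q ^+ (N.+1 - i)) * (1 - q ^+ (N.+2 + i.+1)) *
    (rank_alpha i.+1 / (P (N.+1 - i) * P (N.+2 + i.+1))).
  (* At i = N + 1 the factor 1 - q^(N+1-i) vanishes, so the sum may run one term further. *)
  rewrite [RHS]big_ord_recr /= subnn expr0 subrr !mul0r addr0.
  apply: eq_bigr => i _; have iN := ltn_ord i.
  have -> : (N.+1 - i = (N - i).+1)%N by rewrite subSn// -ltnS.
  rewrite subSS (_ : N.+2 + i.+1 = (N.+1 + i.+1).+1)%N// !qq_pochS.
  by field; rewrite !subq_neq0 !qq_poch_neq0.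
rewrite mulr_sumr -big_split /=; apply: eq_bigr => i _; have iN := ltn_ord i.
rewrite subSS /rank_alpha.
have [e Ne] : exists e, N.+1 = (e + i)%N by exists (N.+1 - i)%N; rewrite subnK.
have -> : q ^+ N.+2 = q ^+ (N.+1 - i) * q ^+ i.+1.
  by rewrite -exprD; congr (_ ^+ _); lia.
have -> : q ^+ (N.+2 + i.+1) = q ^+ (N.+1 - i) * q ^+ i.+1 * q ^+ i.+1.
  by rewrite -!exprD; congr (_ ^+ _); lia.
have := D_neq0 i.
set x := q ^+ i.+1; set y := q ^+ (N.+1 - i); set c := rank_num _.
have -> : (1 - zeta * (y * x)) * (1 - zeta^-1 * (y * x)) =
  y * ((1 - zeta * x) * (1 - zeta^-1 * x)) + (1 - y) * (1 - y * x * x).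
  by field.
move: (_ * (1 - zeta^-1 * x)) => d d0.
by field; rewrite !qq_poch_neq0 d0.
Qed.

(* q^(n^2) times the beta_n obtained after j steps of the Bailey chain. *)
Fixpoint bailey_iter (j n : nat) : C :=
  if j is j'.+1 then
    q ^+ (n ^ 2) * \sum_(m < n.+1) bailey_iter j' m / P (n - m)
  else if n == 0%N then 0
  else q ^+ (n ^ 2) / (qpoch (zeta * q) q n * qpoch (zeta^-1 * q) q n).

(** After exchanging the sums, the one over m is that of [bailey_step] with s = i + 1; the factor
    q^(s^2) it produces raises the exponent j by one. *)
Let bailey_sum j (b : nat -> C) :
  (forall n, b n = q ^+ (n ^ 2) * \sum_(i < n)
     q ^+ (j * i.+1 ^ 2) * rank_alpha i.+1 / (P (n - i.+1) * P (n + i.+1))) ->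
  forall n, \sum_(m < n.+1) b m / P (n - m) =
  \sum_(i < n) q ^+ (j.+1 * i.+1 ^ 2) * rank_alpha i.+1 /
    (P (n - i.+1) * P (n + i.+1)).
Proof.
move=> hb n.
transitivity (\sum_(m < n.+1) \sum_(i < n | (i.+1 <= m)%N)
   q ^+ (j * i.+1 ^ 2) * rank_alpha i.+1 *
   (q ^+ (m ^ 2) / (P (n - m) * P (m - i.+1) * P (m + i.+1)))).
  apply: eq_bigr => m _; have mn : (m <= n)%N by rewrite -ltnS.
  rewrite hb (big_ord_widen_cond n xpredT (fun i => q ^+ (j * i.+1 ^ 2) *
    rank_alpha i.+1 / (P (m - i.+1) * P (m + i.+1))) mn) /= mulr_sumr mulr_suml.
  by apply: eq_bigr => i _; rewrite !invfM; ring.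
rewrite (exchange_big_dep xpredT)//=; apply: eq_bigr => i _.
rewrite -mulr_sumr bailey_step// mulSn exprD; ring.
Qed.

Lemma bailey_iterE j n : bailey_iter j n = q ^+ (n ^ 2) * \sum_(i < n)
     q ^+ (j * i.+1 ^ 2) * rank_alpha i.+1 / (P (n - i.+1) * P (n + i.+1)).
Proof.
elim: j n => [|j ih] n; last by rewrite /= (bailey_sum ih).
case: n => [|n]; first by rewrite big_ord0 mulr0.
rewrite /= rank_bailey_pair//; congr (_ * _); apply: eq_bigr => i _.
by rewrite mul0n expr0 mul1r.
Qed.

Lemma bailey_iter_sum j n : \sum_(m < n.+1) bailey_iter j m / P (n - m) =
  \sum_(i < n) q ^+ (j.+1 * i.+1 ^ 2) * rank_alpha i.+1 /
    (P (n - i.+1) * P (n + i.+1)).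
Proof. exact/bailey_sum/bailey_iterE. Qed.

End BaileyChain.

(** * Sums over sorted tuples as iterated one-step sums *)

Section TupleSums.
Variable V : comNzRingType.

Lemma sum_tuple_cons (T : finType) n (G : n.+1.-tuple T -> V) :
  \sum_t G t = \sum_x \sum_(t : n.-tuple T) G [tuple of x :: t].
Proof.
rewrite pair_big /= (reindex (fun p : T * n.-tuple T => [tuple of p.1 :: p.2])).
  by apply: eq_bigr => -[x t] _.
exists (fun t => (thead t, [tuple of behead t])) => [[x t] _|t _] /=.
  by rewrite theadE; congr (_, _); apply/val_inj.
by rewrite -tuple_eta.
Qed.

Variable c : nat -> nat -> V.

Definition chain_step (a : nat -> V) (m : nat) := \sum_(n < m.+1) a n * c n m.

(** The head of the tuple, its smallest entry, is summed out first: it only meets the second entry,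
    and the result replaces a by [chain_step a]. *)
Lemma chain_sum M j (a : nat -> V) :
  \sum_(t : j.+1.-tuple 'I_M.+1)
    (if sorted leq (map val t) then a (nth 0%N (map val t) 0)
       * \prod_(i < j) c (nth 0%N (map val t) i) (nth 0%N (map val t) i.+1)
     else 0) = \sum_(n < M.+1) iter j chain_step a n.
Proof.
elim: j a => [|j ih] a.
  rewrite sum_tuple_cons; apply: eq_bigr => x _.
  rewrite (big_pred1 [tuple]); last by move=> t; apply/esym/eqP; exact: tuple0.
  by rewrite /= big_ord0 mulr1.
rewrite iterSr -ih sum_tuple_cons exchange_big /=; apply: eq_bigr => t _.
case: (tupleP t) => y {}t /=.
case: ifP => st; last first.
  by rewrite big1// => x _; rewrite andbF.
rewrite /chain_step big_distrl /=.
rewrite (big_ord_widen M.+1 (fun n => a n * c n y * \prod_(i < j)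
   c (nth 0%N (val y :: map val t) i) (nth 0%N (map val t) i)))//.
rewrite [RHS]big_mkcond; apply: eq_bigr => x _ /=.
by rewrite andbT ltnS; case: ifP => // _; rewrite big_ord_recl mulrA.
Qed.

End TupleSums.

(** * Geometric bounds and the q-Pochhammer symbols *)

Section Bounds.
Variable R : realType.
Local Notation C := R[i].

Lemma ler_sum_subset (I : eqType) (r1 r2 : seq I) (G : I -> R) :
  (forall i, 0 <= G i) -> uniq r1 -> uniq r2 -> {subset r1 <= r2} ->
  \sum_(i <- r1) G i <= \sum_(i <- r2) G i.
Proof.
move=> G0 u1 u2 sub; rewrite [leRHS](bigID (mem r1)) /= -[X in X + _]big_filter.
rewrite [X in X + _](perm_big r1) /=; first by rewrite lerDl sumr_ge0.
apply: uniq_perm => //; first exact: filter_uniq.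
by move=> i; rewrite mem_filter /=; case: (boolP (i \in r1)) => //= /sub.
Qed.

Lemma nat_abs_bounded (F : nat -> C) K :
  (forall n, \sum_(r < n) modulus (F r) <= K) -> abs_bounded F K.
Proof.
move=> hK A; set n := (\max_(i <- A) i).+1.
apply: le_trans (hK n); rewrite -(big_mkord xpredT (fun r => modulus (F r))).
apply: ler_sum_subset; rewrite ?iota_uniq//; first by move=> i; exact: modulus_ge0.
move=> i iA; rewrite mem_index_iota /= ltnS.
by have := @leq_bigmax_seq _ (enum_fset A) xpredT id i iA isT.
Qed.

Lemma geometric_sum_le (rho : R) n : 0 <= rho < 1 ->
  \sum_(i < n) rho ^+ i <= (1 - rho)^-1.
Proof.
move=> /andP[r0 r1]; have h : 0 < 1 - rho by rewrite subr_gt0.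
rewrite -[leRHS]mul1r ler_pdivlMr//; have E := subrX1 rho n.
rewrite (_ : _ * _ = 1 - rho ^+ n); last by rewrite -[RHS]opprB E; ring.
by rewrite lerBlDr lerDl exprn_ge0.
Qed.

Lemma nat_geometric_bounded (F : nat -> C) (K rho : R) : 0 <= rho < 1 ->
  (forall n, modulus (F n) <= K * rho ^+ n) -> abs_bounded F (K / (1 - rho)).
Proof.
move=> hr hF; have K0 : 0 <= K.
  by have := hF 0%N; rewrite expr0 mulr1; exact: le_trans (modulus_ge0 _).
apply: nat_abs_bounded => n.
apply: (@le_trans _ _ (\sum_(i < n) K * rho ^+ i)); first exact: ler_sum.
by rewrite -mulr_sumr ler_wpM2l// geometric_sum_le.
Qed.

Lemma pair_geometric_bounded (F : nat * nat -> C) (K rho : R) : 0 <= rho < 1 ->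
  (forall p, modulus (F p) <= K * rho ^+ (p.1 + p.2)) ->
  abs_bounded F (K / (1 - rho) ^+ 2).
Proof.
move=> hr hF A; have K0 : 0 <= K.
  by have := hF (0%N, 0%N); rewrite expr0 mulr1; exact: le_trans (modulus_ge0 _).
have [r0 r1] := andP hr.
apply: (@le_trans _ _ (\sum_(p <- A) K * rho ^+ (p.1 + p.2))); first exact: ler_sum.
rewrite -mulr_sumr ler_wpM2l//.
set n := (\max_(p <- A) maxn p.1 p.2).+1.
apply: le_trans (_ : \sum_(p <- [seq (i, j) | i <- index_iota 0 n, j <- index_iota 0 n])
   rho ^+ (p.1 + p.2) <= _).
  apply: ler_sum_subset => //.
  - by move=> i; exact: exprn_ge0.
  - by apply: allpairs_uniq; rewrite ?iota_uniq// => -[? ?] [? ?].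
  move=> p pA; apply/allpairsP; exists p; rewrite !mem_index_iota !ltnS -surjective_pairing.
  have := @leq_bigmax_seq _ (enum_fset A) xpredT (fun p => maxn p.1 p.2) p pA isT.
  by rewrite geq_max => /andP[].
rewrite big_allpairs big_mkord /=.
apply: le_trans (_ : \sum_(i < n) rho ^+ i * (1 - rho)^-1 <= _).
  apply: ler_sum => i _; rewrite big_mkord (eq_bigr (fun j : 'I_n => rho ^+ i * rho ^+ j)).
    by rewrite -mulr_sumr ler_wpM2l ?exprn_ge0// geometric_sum_le.
  by move=> j _; rewrite exprD.
rewrite -mulr_suml expr2 invfM ler_wpM2r ?geometric_sum_le//.
by rewrite invr_ge0 subr_ge0 ltW.
Qed.

Variable q : C.
Local Notation rho := (modulus q).
Local Notation P := (qpoch q q).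
Hypothesis rho0 : 0 < rho.
Hypothesis rho1 : rho < 1.
Let rho01 : 0 <= rho < 1. Proof. by rewrite (ltW rho0). Qed.
Let rhoX n : 0 <= rho ^+ n <= 1.
Proof. by rewrite exprn_ge0 ?exprn_ile1// ltW. Qed.

Lemma nonroot_of_unity n : q ^+ n.+1 != 1.
Proof.
apply/eqP => /(congr1 (@modulus R)); rewrite modulusX modulus1 => h.
have : rho ^+ n.+1 < 1 by rewrite exprn_ilt1// ltW.
by rewrite h ltxx.
Qed.

(** For 0 <= x <= A < 1, 1/(1 - x) = 1 + x/(1 - x) <= exp(x / (1 - A)). Taking x = A |q|^n and
    multiplying bounds every partial product below by one positive constant. *)
Lemma qpoch_lower (a : C) : modulus a < 1 ->
  exists2 c : R, 0 < c & forall n, c <= modulus (qpoch a q n).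
Proof.
move=> a1; have a0 := modulus_ge0 a; set A := modulus a in a0 a1 *.
have A1 : 0 < 1 - A by rewrite subr_gt0.
exists (expR (- (A / (1 - A) * (1 - rho)^-1))); first exact: expR_gt0.
move=> n; apply: (@le_trans _ _ (expR (- (A / (1 - A) * \sum_(i < n) rho ^+ i)))).
  rewrite ler_expR lerN2 ler_wpM2l ?geometric_sum_le//.
  by rewrite divr_ge0// ltW.
elim: n => [|n ih]; first by rewrite big_ord0 mulr0 oppr0 expR0 qpoch0 modulus1.
rewrite big_ord_recr /= mulrDr opprD expRD qpochS modulusM.
apply: ler_pM; rewrite ?expR_ge0//.
have /andP[x0 x1] := rhoX n.
have h : 1 - A * rho ^+ n <= modulus (1 - a * q ^+ n).
  by have := modulus_ge_dist 1 (a * q ^+ n); rewrite modulus1 modulusM modulusX.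
apply: le_trans h; set x := A * rho ^+ n.
have xA : x <= A by rewrite /x -[leRHS]mulr1 ler_wpM2l.
have xx : 0 <= x by rewrite mulr_ge0.
have e1 := expR_ge1Dx (A / (1 - A) * rho ^+ n).
rewrite expRN -[leRHS]invrK lef_pV2 ?posrE ?invr_gt0 ?expR_gt0//; last by lra.
apply: le_trans e1; rewrite mulrAC -/x.
have -> : (1 - x)^-1 = 1 + x / (1 - x) by field; lra.
rewrite lerD2l ler_wpM2l// lef_pV2 ?posrE; lra.
Qed.

Lemma qpoch_upper (a : C) : exists K : R, forall n, modulus (qpoch a q n) <= K.
Proof.
exists (expR (modulus a * (1 - rho)^-1)) => n.
apply: (@le_trans _ _ (expR (modulus a * \sum_(i < n) rho ^+ i))); last first.
  by rewrite ler_expR ler_wpM2l ?modulus_ge0// geometric_sum_le.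
elim: n => [|n ih]; first by rewrite big_ord0 mulr0 expR0 qpoch0 modulus1.
rewrite big_ord_recr /= mulrDr expRD qpochS modulusM.
apply: ler_pM; rewrite ?modulus_ge0//.
apply: le_trans (modulusB _ _) _; rewrite modulus1 modulusM modulusX.
exact: expR_ge1Dx.
Qed.

(** The increments of (q)_n are geometrically small, so the sequence converges; the uniform lower
    bound keeps the limit away from 0. *)
Lemma euler_prod_clim : clim P (euler_prod q) /\ euler_prod q != 0.
Proof.
have [K hK] := qpoch_upper q; have [c c0 hc] := qpoch_lower rho1.
have [s hs] : exists s, hsum (fun m => P m.+1 - P m) s.
  apply: hsum_ex; apply: (@nat_geometric_bounded _ K rho) => // n.
  rewrite qq_pochS (_ : _ - _ = - (P n * q ^+ n.+1)); last by ring.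
  rewrite modulusN modulusM modulusX; apply: ler_pM; rewrite ?modulus_ge0 ?exprn_ge0//.
    exact: ltW.
  by rewrite exprS ler_piMl ?exprn_ge0// ltW.
have hP : clim P (s + 1).
  have h := @hsum_exhaust R _ _ _ (fun M => iota 0 M) hs (fun M => iota_uniq 0 M).
  apply: clim_ext (climD (h _) (clim_cst 1)) => [M|i].
    have := telescope_sumr P (leq0n M); rewrite /index_iota subn0 => ->.
    by rewrite qpoch0 subrK.
  by exists i.+1 => M iM; rewrite mem_iota add0n.
rewrite /euler_prod (lim_clim hP); split => //.
apply/eqP => s0; have [M /(_ M (leqnn M))] := hP c c0.
by rewrite s0 subr0 ltNge hc.
Qed.

End Bounds.

Section ClimMore.
Variable R : realType.
Local Notation C := R[i].

Lemma clim_eventually (u v : nat -> C) s N : (forall n, (N <= n)%N -> u n = v n) ->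
  clim u s -> clim v s.
Proof.
move=> uv h e /h[M hM]; exists (maxn N M) => n.
by rewrite geq_max => /andP[/uv <- /hM].
Qed.

Lemma clim_reindex (u : nat -> C) s (h : nat -> nat) :
  (forall M, exists N, forall n, (N <= n)%N -> (M <= h n)%N) ->
  clim u s -> clim (fun n => u (h n)) s.
Proof.
move=> hh hu e /hu[M hM]; have [N hN] := hh M.
by exists N => n /hN /hM.
Qed.

End ClimMore.

(** * Summability over tuples *)

Section TupleBounds.
Variable R : realType.
Local Notation C := R[i].

Lemma sum_tuple_prod n M (rho : R) :
  \sum_(t : n.-tuple 'I_M) \prod_(x <- map val t) rho ^+ x =
  (\sum_(x < M) rho ^+ x) ^+ n.
Proof.
elim: n => [|n ih].
  rewrite (big_pred1 [tuple]); last by move=> t; apply/esym/eqP; exact: tuple0.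
  by rewrite big_nil.
rewrite sum_tuple_cons exprS mulr_suml; apply: eq_bigr => x _.
by rewrite -ih mulr_sumr; apply: eq_bigr => t _ /=; rewrite big_cons.
Qed.

Definition bounded_tuples n M : seq (n.-tuple nat) :=
  [seq [tuple of map val t] | t : n.-tuple 'I_M].

Lemma bounded_tuples_uniq n M : uniq (bounded_tuples n M).
Proof.
rewrite map_inj_uniq ?enum_uniq// => t u /(congr1 val) /= /(inj_map val_inj) h.
exact: val_inj.
Qed.

Lemma mem_bounded_tuples n M (t : n.-tuple nat) :
  all (fun x => x < M)%N t -> t \in bounded_tuples n M.
Proof.
rewrite /bounded_tuples; case: M => [|M] tM.
  case: n t tM => [|n] t tM; last by case/tupleP: t tM => x t /=.
  by apply/mapP; exists [tuple]; rewrite ?mem_enum// [t]tuple0; apply/val_inj.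
apply/mapP; exists [tuple of map inord t]; first by rewrite mem_enum.
apply/val_inj => /=; rewrite -map_comp -[LHS]map_id.
apply/eq_in_map => x xt /=; rewrite inordK//.
exact: (allP tM).
Qed.

Lemma tuple_geometric_bounded n (F : n.-tuple nat -> C) (K rho : R) :
  0 <= rho < 1 ->
  (forall t, modulus (F t) <= K * \prod_(x <- t) rho ^+ x) ->
  abs_bounded F (K * (1 - rho)^-1 ^+ n).
Proof.
move=> hr hF A; have [r0 r1] := andP hr.
have p0 (t : seq nat) : 0 <= \prod_(x <- t) rho ^+ x.
  by apply: prodr_ge0 => x _; exact: exprn_ge0.
have K0 : 0 <= K.
  have := hF [tuple of nseq n 0%N].
  rewrite /= big_nseq expr0 iter_mulr_1 expr1n mulr1.
  exact: le_trans (modulus_ge0 _).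
apply: (@le_trans _ _ (\sum_(t <- A) K * \prod_(x <- t) rho ^+ x)); first exact: ler_sum.
rewrite -mulr_sumr ler_wpM2l//.
set M := (\max_(t <- A) \max_(x <- t) x).+1.
apply: (@le_trans _ _ (\sum_(t <- bounded_tuples n M) \prod_(x <- t) rho ^+ x)).
  apply: (@ler_sum_subset _ (n.-tuple nat) (enum_fset A) (bounded_tuples n M)
    (fun t : n.-tuple nat => \prod_(x <- t) rho ^+ x)).
  - by move=> t; exact: p0.
  - exact: fset_uniq.
  - exact: bounded_tuples_uniq.
  move=> t tA; apply: mem_bounded_tuples; apply/allP => x xt; rewrite ltnS.
  have h1 := @leq_bigmax_seq _ (tval t) xpredT id x xt isT.
  have h2 := @leq_bigmax_seq _ (enum_fset A) xpredT
    (fun t : n.-tuple nat => \max_(x <- t) x)%N t tA isT.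
  exact: leq_trans h1 h2.
rewrite /bounded_tuples big_image /= sum_tuple_prod.
by apply: lerXn2r; rewrite ?nnegrE ?invr_ge0 ?subr_ge0 ?(ltW r1)// ?geometric_sum_le//
   sumr_ge0// => i _; rewrite exprn_ge0.
Qed.

End TupleBounds.

(** * Garvan's formula: the limit of the Bailey chain *)

Section Garvan.
Variable R : realType.
Local Notation C := R[i].
Variables (q zeta : C).
Local Notation rho := (modulus q).
Local Notation P := (qpoch q q).
Hypothesis rho0 : 0 < rho.
Hypothesis rho1 : rho < 1.
Hypothesis zeta0 : zeta != 0.
Hypothesis zq1 : modulus (zeta * q) < 1.
Hypothesis zq2 : modulus (zeta^-1 * q) < 1.

Let rho01 : 0 <= rho < 1. Proof. by rewrite (ltW rho0). Qed.
Let rhoX n : 0 <= rho ^+ n <= 1.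
Proof. by rewrite exprn_ge0 ?exprn_ile1// ltW. Qed.
Let qroot := nonroot_of_unity rho0 rho1.

Let factor_lower a r : modulus (a * q) < 1 ->
  1 - modulus (a * q) <= modulus (1 - a * q ^+ r.+1).
Proof.
move=> h; have := modulus_ge_dist 1 (a * q ^+ r.+1).
rewrite modulus1; apply: le_trans; rewrite lerD2l lerN2 exprS mulrA modulusM modulusX.
by rewrite ler_piMr ?modulus_ge0//; have /andP[] := rhoX r.
Qed.

Let D_lower r : (1 - modulus (zeta * q)) * (1 - modulus (zeta^-1 * q)) <=
  modulus ((1 - zeta * q ^+ r.+1) * (1 - zeta^-1 * q ^+ r.+1)).
Proof.
by rewrite [leRHS]modulusM; apply: ler_pM; rewrite ?subr_ge0 ?(ltW zq1) ?(ltW zq2)// factor_lower.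
Qed.

Let D0 : 0 < (1 - modulus (zeta * q)) * (1 - modulus (zeta^-1 * q)).
Proof. by rewrite mulr_gt0// subr_gt0. Qed.

Lemma rank_den_neq0 r : (1 - zeta * q ^+ r.+1) * (1 - zeta^-1 * q ^+ r.+1) != 0.
Proof. by rewrite -modulus_gt0; apply: lt_le_trans (D_lower r). Qed.

Lemma rank_alpha_bound : exists2 K, 0 <= K & forall r,
  modulus (rank_alpha q zeta r.+1) <= K * rho ^+ r.
Proof.
exists (4 / ((1 - modulus (zeta * q)) * (1 - modulus (zeta^-1 * q)))).
  by rewrite divr_ge0// ltW.
move=> r; rewrite /rank_alpha [leLHS]modulusM modulusV mulrAC.
apply: ler_pM; rewrite ?modulus_ge0 ?invr_ge0 ?modulus_ge0//; last first.
  by rewrite lef_pV2 ?posrE ?modulus_gt0 ?rank_den_neq0// D_lower.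
have h2 n : modulus (1 - q ^+ n) <= 2.
  apply: le_trans (modulusB _ _) _; rewrite modulus1 modulusX.
  by have /andP[] := rhoX n; lra.
rewrite /rank_num !modulusM !modulusX modulusN modulus1 expr1n mul1r.
rewrite (_ : 4 * rho ^+ r = rho ^+ r * 2 * 2); last by ring.
apply: ler_pM; rewrite ?mulr_ge0 ?modulus_ge0 ?exprn_ge0 ?modulus_ge0 ?h2//.
apply: ler_pM; rewrite ?modulus_ge0 ?exprn_ge0 ?modulus_ge0 ?h2//.
rewrite binS bin1 exprD ler_piMl//; have /andP[] := rhoX r; rewrite // => _ _.
by have /andP[] := rhoX 'C(r, 2).
Qed.

Variable j : nat.
Let b := bailey_iter q zeta j.
Let wa i := q ^+ (j.+1 * i.+1 ^ 2) * rank_alpha q zeta i.+1.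

Let term_bound (K c : R) (x : C) m n : 0 < c -> (forall n, c <= modulus (P n)) ->
  modulus x <= K -> modulus (x / (P m * P n)) <= K / c ^+ 2.
Proof.
move=> c0 hc hx; rewrite modulusM modulusV modulusM.
apply: ler_pM; rewrite ?modulus_ge0 ?invr_ge0 ?mulr_ge0 ?modulus_ge0//.
rewrite lef_pV2 ?posrE ?exprn_gt0// ?mulr_gt0 ?modulus_gt0 ?qq_poch_neq0//.
by rewrite expr2; apply: ler_pM; rewrite ?(ltW c0).
Qed.

Let qX_le (x : C) n : modulus (q ^+ n * x) <= modulus x.
Proof.
rewrite modulusM modulusX ler_piMl ?modulus_ge0//.
by have /andP[] := rhoX n.
Qed.

Lemma bailey_iter_bound : exists2 K, 0 <= K & forall n, modulus (b n) <= K * rho ^+ n.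
Proof.
have [K K0 hK] := rank_alpha_bound.
have [c c0 hc] := qpoch_lower rho0 rho1 rho1.
exists (K / c ^+ 2 * (1 - rho)^-1).
  by rewrite mulr_ge0// ?divr_ge0 ?exprn_ge0 ?invr_ge0 ?subr_ge0 ?(ltW rho1) ?(ltW c0).
move=> n; rewrite /b bailey_iterE//; last exact: rank_den_neq0.
rewrite modulusM mulrC modulusX; apply: ler_pM; rewrite ?modulus_ge0 ?exprn_ge0 ?modulus_ge0//.
  apply: le_trans (modulus_sum _ _ _) _.
  apply: (@le_trans _ _ (\sum_(i < n) K / c ^+ 2 * rho ^+ i)); last first.
    rewrite -mulr_sumr ler_wpM2l ?geometric_sum_le//.
    by rewrite divr_ge0 ?exprn_ge0 ?(ltW c0).
  apply: ler_sum => i _; rewrite [leRHS]mulrAC; apply: term_bound => //.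
  exact: le_trans (qX_le _ _) (hK i).
apply: ler_wiXn2l; rewrite ?(ltW rho0) ?(ltW rho1)//.
by case: n => // n; rewrite expnS expn1 leq_pmulr.
Qed.

(** The two sides of [bailey_iter_sum] tend to S / E and G / E^2, where E = (q)_oo and G is the sum
    of the [wa i]; hence G = E S. *)
Lemma bailey_limit (S : C) : clim (fun M => \sum_(m < M) b m) S ->
  clim (fun M => \sum_(i < M) wa i) (euler_prod q * S).
Proof.
move=> hS; have [hE E0] := euler_prod_clim rho0 rho1.
set E := euler_prod q in hE E0 *.
have [c c0 hc] := qpoch_lower rho0 rho1 rho1.
have [K K0 hK] := rank_alpha_bound.
have [Kb Kb0 hKb] := bailey_iter_bound.
have wa_bound i : modulus (wa i) <= K * rho ^+ i.
  exact: le_trans (qX_le _ _) (hK i).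
have [G hG] : exists G, clim (fun M => \sum_(i < M) wa i) G.
  have [G hG] := hsum_ex (nat_geometric_bounded rho01 wa_bound).
  exists G; have := @hsum_exhaust _ _ _ _ (fun M => iota 0 M) hG (fun M => iota_uniq 0 M).
  move=> h; apply: clim_ext (h _) => [M|i].
    by rewrite -(big_mkord xpredT) /index_iota subn0.
  by exists i.+1 => M iM; rewrite mem_iota add0n.
have geo_bd (L : R) : 0 <= L -> forall n, \sum_(r < n) L * rho ^+ r <= L / (1 - rho).
  by move=> L0 n; rewrite -mulr_sumr ler_wpM2l// geometric_sum_le.
(* Here M counts the terms, so the truncation is n = M - 1. The zero branch extends the summand to
   all m, since [tannery] asks for a bound for every pair. *)
have lim1 : clim (fun M => \sum_(m < M) (if (m < M)%N then b m / P (M.-1 - m) else 0)) (S / E).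
  apply: (@tannery _ (fun m M => if (m < M)%N then b m / P (M.-1 - m) else 0)
    (fun m => b m / E) (fun m => Kb / c * rho ^+ m)).
  - by apply: geo_bd; rewrite divr_ge0// ltW.
  - move=> m M; case: ifP => _; last first.
      by rewrite modulus0 mulr_ge0 ?divr_ge0 ?exprn_ge0 ?modulus_ge0// ltW.
    rewrite modulusM modulusV [leRHS]mulrAC.
    apply: ler_pM => //; rewrite ?modulus_ge0 ?invr_ge0 ?modulus_ge0//.
    by rewrite lef_pV2 ?posrE ?modulus_gt0 ?qq_poch_neq0.
  - move=> m; apply: (@clim_eventually _ (fun M => b m / P (M.-1 - m)) _ _ m.+1).
      by move=> M mM; rewrite mM.
    apply/climZ/climV => //; apply: (clim_reindex _ hE) => M.
    by exists (M + m).+1 => n; lia.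
  - have := climZ E^-1 hS; rewrite mulrC; apply: clim_ext => M.
    by rewrite mulr_sumr; apply: eq_bigr => m _; rewrite mulrC.
have lim2 : clim (fun M => \sum_(i < M) (if (i < M)%N then
     wa i / (P (M - i.+1) * P (M + i.+1)) else 0)) (G / E ^+ 2).
  apply: (@tannery _ (fun i M => if (i < M)%N then
     wa i / (P (M - i.+1) * P (M + i.+1)) else 0)
    (fun i => wa i / (E * E)) (fun i => K / c ^+ 2 * rho ^+ i)).
  - by apply: geo_bd; rewrite divr_ge0// exprn_ge0// ltW.
  - move=> i M; case: ifP => _; last first.
      by rewrite modulus0 mulr_ge0 ?divr_ge0 ?exprn_ge0 ?modulus_ge0// ltW.
    by rewrite [leRHS]mulrAC; apply: term_bound.
  - move=> i; apply: (@clim_eventually _ (fun M => wa i / (P (M - i.+1) * P (M + i.+1))) _ _ i.+1).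
      by move=> M iM; rewrite iM.
    apply/climZ/climV; first by rewrite mulf_neq0.
    apply: climM; apply: (clim_reindex _ hE) => M; exists (M + i.+1)%N => n; lia.
  - have := climZ (E ^- 2) hG; rewrite mulrC; apply: clim_ext => M.
    by rewrite mulr_sumr; apply: eq_bigr => m _; rewrite mulrC expr2.
have EG : S / E = G / E ^+ 2.
  apply: clim_uniq (clim_shift 1 lim1) (clim_ext _ lim2) => M.
  rewrite addn1 (eq_bigr (fun m : 'I_M.+1 => b m / P (M - m))); last first.
    by move=> m _; rewrite ltn_ord.
  rewrite /b bailey_iter_sum//; last exact: rank_den_neq0.
  by apply: eq_bigr => i _; rewrite ltn_ord.
have -> : E * S = G.
  by have := congr1 (fun x => x * E ^+ 2) EG; rewrite mulfVK ?expf_neq0// => <-; field.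
exact: hG.
Qed.

End Garvan.

(** * The complex exponential and the nome *)

Section ComplexExp.
Variable R : realType.
Local Notation C := R[i].
Implicit Types z w : C.

Lemma cexp0 : cexp (0 : C) = 1.
Proof. by rewrite /cexp /= expR0 cos0 sin0 mul1r. Qed.

Lemma cexpD z w : cexp (z + w) = cexp z * cexp w.
Proof.
case: z w => a b [c d]; rewrite /cexp /= expRD rmorphM /= cosD sinD.
rewrite mulrACA; congr (_ * _); apply/eqP; rewrite eq_complex /=.
by rewrite [sin b * _ + _]addrC !eqxx.
Qed.

Lemma cexpN z : cexp (- z) = (cexp z)^-1.
Proof.
have h : cexp z * cexp (- z) = 1 by rewrite -cexpD subrr cexp0.
have z0 : cexp z != 0.
  by apply/eqP => e; move: h; rewrite e mul0r => /esym/eqP; rewrite oner_eq0.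
by apply: (mulfI z0); rewrite h divff.
Qed.

Lemma cexp_neq0 z : cexp z != 0.
Proof.
apply/eqP => e; have : cexp z * cexp (- z) = 1 by rewrite -cexpD subrr cexp0.
by rewrite e mul0r => /esym/eqP; rewrite oner_eq0.
Qed.

Lemma cexpMn z n : cexp (n%:R * z) = cexp z ^+ n.
Proof.
elim: n => [|n ih]; first by rewrite mul0r cexp0.
by rewrite -natr1 mulrDl mul1r cexpD ih exprSr.
Qed.

Lemma modulus_cexp z : modulus (cexp z) = expR (complex.Re z).
Proof.
rewrite modulusM modulus_real ger0_norm ?expR_ge0// /modulus /=.
by rewrite cos2Dsin2 sqrtr1 mulr1.
Qed.

Lemma modulus_nome (tau : C) : upper_half_plane tau ->
  0 < modulus (nome tau) < 1.
Proof.
move=> h; have {h} : 0 < complex.Im tau by exact: h.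
rewrite /nome modulus_cexp expR_gt0 expR_lt1; case: tau => a b /= h.
have := pi_gt0 R => p0.
rewrite /two_pi_i /cpi /=; simpc => /=; nra.
Qed.

End ComplexExp.

Section IntBound.
Variable R : realType.
Local Notation C := R[i].

Definition int_range M : seq int := map Posz (iota 0 M.+1) ++ map Negz (iota 0 M).

Lemma int_range_uniq M : uniq (int_range M).
Proof.
rewrite cat_uniq !map_inj_uniq ?iota_uniq; try by move=> ? ? [].
by rewrite andbT /=; apply/hasPn => _ /mapP[m _ ->]; apply/mapP => -[].
Qed.

Lemma mem_int_range (n : int) M : (`|n| <= M)%N -> n \in int_range M.
Proof.
by case: n => m mM; rewrite mem_cat map_f ?orbT// mem_iota add0n.
Qed.

Lemma int_range_sum (V : nmodType) M (F : int -> V) :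
  \sum_(n <- int_range M) F n = \sum_(i < M.+1) F (Posz i) + \sum_(i < M) F (Negz i).
Proof.
rewrite big_cat !big_map; congr (_ + _).
  by rewrite -(big_mkord xpredT (fun i => F (Posz i))) /index_iota subn0.
by rewrite -(big_mkord xpredT (fun i => F (Negz i))) /index_iota subn0.
Qed.

Lemma int_geometric_bounded (F : int -> C) (K rho : R) : 0 <= rho < 1 ->
  (forall n, modulus (F n) <= K * rho ^+ `|n|) -> abs_bounded F (2 * (K / (1 - rho))).
Proof.
move=> hr hF A; have [r0 r1] := andP hr.
have K0 : 0 <= K.
  have := hF 0; rewrite /= expr0 mulr1; exact: le_trans (modulus_ge0 _).
set M := (\max_(n <- A) `|n|)%N.
apply: (@le_trans _ _ (\sum_(n <- int_range M) K * rho ^+ `|n|)).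
  apply: (@le_trans _ _ (\sum_(n <- A) K * rho ^+ `|n|)); first exact: ler_sum.
  apply: ler_sum_subset; rewrite ?int_range_uniq ?fset_uniq//.
    by move=> n; rewrite mulr_ge0 ?exprn_ge0.
  move=> n nA; apply: mem_int_range.
  exact: (@leq_bigmax_seq _ (enum_fset A) xpredT (fun n : int => `|n|%N) n nA isT).
rewrite int_range_sum -mulr_sumr (_ : 2 * _ = K / (1 - rho) + K / (1 - rho)); last by ring.
apply: lerD; first by rewrite ler_wpM2l// geometric_sum_le.
rewrite -mulr_sumr ler_wpM2l//; apply: le_trans (geometric_sum_le M hr).
by apply: ler_sum => i _; rewrite /= exprS ler_piMl ?exprn_ge0// ltW.
Qed.

End IntBound.

(** * The theta function as a one-sided series *)

Section Theta.
Variable R : realType.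
Local Notation C := R[i].
Variables (j : nat) (tau : C).
Hypothesis htau : upper_half_plane tau.
Local Notation q := (nome tau).

Lemma bin2_double m : (2 * 'C(m, 2) + m = m ^ 2)%N.
Proof.
elim: m => // m ih; rewrite binS bin1 mulnDr.
by move: ih; rewrite !expnS !expn0; lia.
Qed.

(* r (b r - 1) / 2 for b = 2 (j + 2) - 1. *)
Definition theta_exp r := (j.+1 * r ^ 2 + 'C(r, 2))%N.

Lemma theta_exp_ge r : (r <= theta_exp r)%N.
Proof.
rewrite /theta_exp; case: r => // r; rewrite expnS expn1.
by apply: leq_trans (leq_addr _ _); nia.
Qed.

Let cexp_half (n : int) (e : nat) : n = 2 * e%:Z ->
  cexp (two_pi_i R * tau * (n%:~R / 2)) = q ^+ e.
Proof.
move=> ->; rewrite -cexpMn; congr cexp.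
have -> : (2 * e%:Z)%:~R = 2 * e%:R :> C by rewrite intrM -!pmulrn.
by field.
Qed.

(** The value of (b n^2 + n) / 2, an integer because b is odd. *)
Let expo (n : int) : nat := match n with
  | Posz m => theta_exp m + m | Negz m => theta_exp m.+1 end.

Lemma theta_clim :
  clim (fun M => 1 + \sum_(i < M) (-1) ^+ i.+1 * q ^+ theta_exp i.+1 * (1 + q ^+ i.+1))
    (theta 1 (2 * (j.+2)%:Z - 1) tau).
Proof.
have /andP[r0 r1] := modulus_nome htau.
set F := fun n : int => (-1) ^ n * cexp (two_pi_i R * tau *
  (((2 * (j.+2)%:Z - 1) * n ^+ 2 + 1 * n)%:~R / 2)).
have FE n : F n = (-1) ^+ `|n| * q ^+ expo n.
  rewrite /F; congr (_ * _).
    by case: n => m //=; rewrite -[LHS]/((-1) ^- m.+1) -exprVn invrN1.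
  apply: cexp_half; case: n => m /=; rewrite /theta_exp.
    have := bin2_double m; rewrite !expnS expn0 expr2; nia.
  have := bin2_double m.+1; rewrite !expnS expn0 expr2 NegzE; nia.
have Fb n : modulus (F n) <= 1 * modulus q ^+ `|n|.
  rewrite FE modulusM !modulusX modulusN modulus1 expr1n; apply: ler_pM => //.
    by rewrite exprn_ge0 ?modulus_ge0.
  apply: ler_wiXn2l; rewrite ?modulus_ge0 ?(ltW r1)//.
  case: n => m /=; last exact: theta_exp_ge.
  exact: leq_trans (theta_exp_ge m) (leq_addr _ _).
have [|s hs] := hsum_ex (int_geometric_bounded _ Fb).
  by rewrite modulus_ge0.
have -> : theta 1 (2 * (j.+2)%:Z - 1) tau = s by apply: sum_overE.
have h := hsum_exhaust hs int_range_uniq.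
apply: clim_ext (h _) => [M|n]; last first.
  by exists `|n|%N => M; exact: mem_int_range.
have F0 : F 0 = 1 by rewrite FE /= /theta_exp exp0n// muln0 !expr0 mul1r.
(* Apart from n = 0, the terms n = i + 1 and n = -(i + 1), which is [Negz i], are paired. *)
rewrite int_range_sum big_ord_recl -addrA -big_split /=.
congr (_ + _); first exact: F0.
by apply: eq_bigr => i _; rewrite !FE /= /bump add1n exprD; ring.
Qed.

End Theta.

(* The right-hand side has nonnegative coefficients, so the defect at (a, b) is
   dominated by the defect at (|a|, |b|), which vanishes in the limit by the
   real functional equation. *)
Lemma exp_psum_defect (F : numFieldType) (a b : F) N :
  (\sum_(i < N) a ^+ i / i`!%:R) * (\sum_(i < N) b ^+ i / i`!%:R)
   - \sum_(i < N) (a + b) ^+ i / i`!%:R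
  = \sum_(i < N) \sum_(l < N | (N <= i + l)%N) a ^+ i / i`!%:R * (b ^+ l / l`!%:R).
Proof.
have -> : \sum_(i < N) (a + b) ^+ i / i`!%:R =
    \sum_(i < N) \sum_(l < N | ~~ (N <= i + l)%N) a ^+ i / i`!%:R * (b ^+ l / l`!%:R).
  transitivity (\sum_(n < N) \sum_(i < N | (i <= n)%N)
      a ^+ i / i`!%:R * (b ^+ (n - i) / (n - i)`!%:R)).
    apply: eq_bigr => n _.
    rewrite addrC exprDn mulr_suml (big_ord_widen_cond N xpredT (fun i =>
      b ^+ (n - i) * a ^+ i *+ 'C(n, i) / n`!%:R))//=.
    apply: eq_big => [i|i]; first by rewrite ltnS.
    rewrite ltnS => il; rewrite -(bin_fact il) !natrM -mulr_natr.
    have f0 k : k`!%:R != 0 :> F by rewrite pnatr_eq0 -lt0n fact_gt0.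
    have c0 : 'C(n, i)%:R != 0 :> F by rewrite pnatr_eq0 -lt0n bin_gt0.
    by field; rewrite !f0 c0.
  rewrite (exchange_big_dep xpredT)//=; apply: eq_bigr => i _.
  pose G (n : nat) := a ^+ i / i`!%:R * (b ^+ (n - i) / (n - i)`!%:R).
  have iN := ltn_ord i.
  rewrite -[LHS](big_geq_mkord i N xpredT G) -[X in \sum_(X <= _ < _) _]add0n.
  rewrite big_addn big_mkord.
  rewrite (big_ord_widen_cond N xpredT (fun l => G (l + i)%N)) ?leq_subr//=.
  apply: eq_big => [l|l _]; first by rewrite -ltnNge ltn_subRL addnC.
  by rewrite /G addnK.
rewrite mulr_suml -sumrB; apply: eq_bigr => i _.
by rewrite mulr_sumr (bigID (fun l : 'I_N => (N <= i + l)%N)) /= addrK.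
Qed.

(** * The exponential series of [cexp] and its Taylor remainder *)

Section ExpSeries.
Local Open Scope classical_set_scope.
Local Open Scope ring_scope.
Variable R : realType.
Local Notation C := R[i].

Definition exp_psum (z : C) N := \sum_(i < N) z ^+ i / i`!%:R.

Let real_exp_psum (x : R) N :
  exp_psum x%:C%C N = (\sum_(i < N) x ^+ i / i`!%:R)%:C%C.
Proof.
rewrite rmorph_sum; apply: eq_bigr => i _.
by rewrite rmorphM rmorphXn fmorphV rmorph_nat.
Qed.

Let clim_real (u : nat -> R) (x : R) : u n @[n --> \oo] --> x ->
  clim (fun n => (u n)%:C%C) x%:C%C.
Proof.
move=> /cvgrPdist_lt h e e0; have [M _ hM] := h e e0.
exists M => n Mn; rewrite (_ : _ - _ = (u n - x)%:C%C); last by rewrite rmorphB.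
by rewrite modulus_real distrC; exact: hM.
Qed.

Let clim_real_exp (x : R) : clim (exp_psum x%:C%C) (expR x)%:C%C.
Proof.
have h := clim_real (@is_cvg_series_exp_coeff R x).
apply: clim_ext h => N; rewrite real_exp_psum /series /= big_mkord.
by [].
Qed.

Lemma real_exp_psum_le (x : R) N : 0 <= x -> \sum_(i < N) x ^+ i / i`!%:R <= expR x.
Proof.
move=> x0; have := nondecreasing_cvgn_le _ (@is_cvg_series_exp_coeff R x) N.
rewrite /series /= big_mkord; apply.
apply: nondecreasing_series => n _ _.
by rewrite /exp_coeff /= divr_ge0 ?exprn_ge0.
Qed.

Let clim_imag_exp (x : R) : clim (exp_psum ('i%C * x%:C%C)) (Complex (cos x) (sin x)).
Proof.
have hc := clim_real (@is_cvg_series_cos_coeff R x).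
have hs := clim_real (@is_cvg_series_sin_coeff R x).
have := climD hc (climZ 'i%C hs).
have cE : limn (series (cos_coeff x)) = cos x by rewrite unlock.
have sE : limn (series (sin_coeff x)) = sin x by rewrite unlock.
rewrite cE sE.
have -> : (cos x)%:C%C + 'i%C * (sin x)%:C%C = Complex (cos x) (sin x).
  by rewrite [RHS]complexE.
apply: clim_ext => N; rewrite /series /= !big_mkord !rmorph_sum mulr_sumr -big_split /=.
apply: eq_bigr => i _.
have -> : cos_coeff x i = (~~ odd i)%:R * (-1) ^+ i./2 * (x ^+ i / i`!%:R).
  by rewrite /cos_coeff /= -!mulrA.
have -> : sin_coeff x i = (odd i)%:R * (-1) ^+ i.-1./2 * (x ^+ i / i`!%:R).
  by rewrite /sin_coeff /= -!mulrA.
rewrite exprMn -[RHS]mulrA.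
have -> : x%:C%C ^+ i / i`!%:R = (x ^+ i / i`!%:R)%:C%C :> C.
  by rewrite rmorphM rmorphXn fmorphV rmorph_nat.
set X := x ^+ i / _; clearbody X.
have e2 (m : nat) : 'i%C ^+ m.*2 = (-1) ^+ m :> C by rewrite -mul2n exprM sqr_i.
rewrite -[in RHS](odd_double_half i) exprD e2.
have rm (m : nat) : ((-1) ^+ m)%:C%C = (-1) ^+ m :> C by rewrite rmorphXn rmorphN1.
rewrite !rmorphM !rmorphXn !rmorphN1 !rmorph_nat /=; move: (X%:C%C) => Z.
case: (boolP (odd i)) => oi; rewrite /= ?mul0r ?mulr0 ?add0r ?addr0 ?mul1r ?expr1.
  rewrite mulrA; congr (_ * _ ^+ _ * _).
  by rewrite -{1}(odd_double_half i) oi /= doubleK.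
done.
Qed.

Let clim_expM (a b A B : C) : clim (exp_psum a) A -> clim (exp_psum b) B ->
  clim (exp_psum (a + b)) (A * B).
Proof.
move=> ha hb.
pose r N := (\sum_(i < N) modulus a ^+ i / i`!%:R) * (\sum_(i < N) modulus b ^+ i / i`!%:R)
   - \sum_(i < N) (modulus a + modulus b) ^+ i / i`!%:R.
have hr : clim (fun N => (r N)%:C%C) 0.
  have := climD (climM (clim_real_exp (modulus a)) (clim_real_exp (modulus b)))
    (climZ (-1) (clim_real_exp (modulus a + modulus b))).
  rewrite -rmorphM -expRD mulN1r subrr; apply: clim_ext => N.
  by rewrite !real_exp_psum mulN1r -rmorphM -rmorphB.
have hd : clim (fun N => - (exp_psum a N * exp_psum b N - exp_psum (a + b) N)) 0.
  move=> e /hr[M hM]; exists M => N /hM; rewrite !subr0 modulus_real modulusN => h.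
  apply: le_lt_trans h; apply: le_trans (ler_norm _).
  rewrite /exp_psum exp_psum_defect /r exp_psum_defect.
  apply: le_trans (modulus_sum _ _ _) _; apply: ler_sum => i _.
  apply: le_trans (modulus_sum _ _ _) _; apply: ler_sum => l _.
  by rewrite !modulusM !modulusV !modulusX !modulus_nat.
have := climD (climM ha hb) hd; rewrite addr0; apply: clim_ext => N.
by rewrite opprB addrC subrK.
Qed.

(** Since [cexp] is built from [expR], [cos] and [sin], the real and the imaginary exponent are
    treated apart and joined by [clim_expM]. *)
Lemma clim_exp_psum (z : C) : clim (exp_psum z) (cexp z).
Proof.
rewrite {1}[z]complexE; have := clim_expM (clim_real_exp (complex.Re z))
  (clim_imag_exp (complex.Im z)).
exact.
Qed.

(** In the tail, (N + i)! >= i! bounds each term by |z|^N |z|^i / i!. *)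
Lemma cexp_taylor (z : C) N :
  modulus (cexp z - exp_psum z N) <= modulus z ^+ N * expR (modulus z).
Proof.
apply: (@clim_dist _ _ _ _ _ (clim_shift N (clim_exp_psum z))) => n.
rewrite /exp_psum -!(big_mkord xpredT (fun i => z ^+ i / i`!%:R)).
have -> : \sum_(0 <= i < n + N) z ^+ i / i`!%:R - \sum_(0 <= i < N) z ^+ i / i`!%:R =
   \sum_(N <= i < n + N) z ^+ i / i`!%:R.
  by rewrite [X in X - _](big_cat_nat (n := N)) ?leq_addl//= addrAC subrr add0r.
apply: le_trans (modulus_sum _ _ _) _.
rewrite -{1}[N]add0n big_addn addnK big_mkord.
apply: (@le_trans _ _ (\sum_(i < n) modulus z ^+ N * (modulus z ^+ i / i`!%:R))).
  apply: ler_sum => i _; rewrite exprD modulusM modulusM !modulusX modulusV modulus_nat.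
  rewrite [_ ^+ i * _]mulrC -mulrA ler_wpM2l ?exprn_ge0 ?modulus_ge0//.
  rewrite ler_wpM2l ?exprn_ge0 ?modulus_ge0// lef_pV2 ?posrE ?ltr0n ?fact_gt0//.
  by rewrite ler_nat leq_fact// leq_addr.
rewrite -mulr_sumr ler_wpM2l ?exprn_ge0 ?modulus_ge0//.
exact/real_exp_psum_le/modulus_ge0.
Qed.

End ExpSeries.

(** * FG_k as the sum of an iterate of the Bailey chain *)

Section FGLimit.
Variable R : realType.
Local Notation C := R[i].
Variables (q zeta : C).
Local Notation rho := (modulus q).
Local Notation P := (qpoch q q).
Hypothesis rho0 : 0 < rho.
Hypothesis rho1 : rho < 1.
Hypothesis zeta0 : zeta != 0.
Hypothesis zq1 : modulus (zeta * q) < 1.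
Hypothesis zq2 : modulus (zeta^-1 * q) < 1.
Variable j : nat.
Local Notation b := (bailey_iter q zeta).

Let FGE (t : (j.+1).-tuple nat) : @FG_term R j.+2 zeta q t =
  q ^+ (\sum_(i < j.+1) nth 0%N t i ^ 2)%N /
  ((\prod_(i < j) P (nth 0%N t i.+1 - nth 0%N t i)) *
   qpoch (zeta * q) q (nth 0%N t 0) * qpoch (zeta^-1 * q) q (nth 0%N t 0)).
Proof. by rewrite /FG_term !big_add1 /= !big_mkord. Qed.

Let FG_term_bound : exists K, forall t,
  modulus (@FG_term R j.+2 zeta q t) <= K * \prod_(x <- t) rho ^+ x.
Proof.
have [c c0 hc] := qpoch_lower rho0 rho1 rho1.
have [c1 c10 hc1] := qpoch_lower rho0 rho1 zq1.
have [c2 c20 hc2] := qpoch_lower rho0 rho1 zq2.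
exists (c ^+ j * c1 * c2)^-1 => t.
rewrite FGE modulusM modulusV modulusX mulrC.
have cj : 0 < c ^+ j by rewrite exprn_gt0.
have den : c ^+ j * c1 * c2 <= modulus ((\prod_(i < j) P (nth 0%N t i.+1 - nth 0%N t i)) *
   qpoch (zeta * q) q (nth 0%N t 0) * qpoch (zeta^-1 * q) q (nth 0%N t 0)).
  rewrite !(modulusM (_ * _)) [modulus (_ * qpoch _ _ _)]modulusM modulus_prod.
  apply: ler_pM; rewrite ?mulr_ge0 ?(ltW cj) ?(ltW c10) ?(ltW c20)//.
  apply: ler_pM; rewrite ?(ltW cj) ?(ltW c10)//.
  rewrite -[j in X in X <= _]card_ord -prodr_const.
  by apply: ler_prod => i _; rewrite (ltW c0) hc.
apply: ler_pM; rewrite ?invr_ge0 ?modulus_ge0 ?exprn_ge0 ?modulus_ge0//.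
  rewrite lef_pV2 ?posrE// ?(lt_le_trans _ den)//; by rewrite !mulr_gt0.
rewrite prodrXr; apply: ler_wiXn2l; rewrite ?(ltW rho0) ?(ltW rho1)//.
rewrite (big_nth 0%N) size_tuple big_mkord; apply: leq_sum => i _.
by case: (nth _ _ _) => // n; rewrite expnS expn1 leq_pmulr.
Qed.

(** The tuples with all entries at most n exhaust the index set, and by [chain_sum] their
    contribution is a partial sum of [b j]; the step from n_i to n_(i+1) has weight q^(n_(i+1)^2) /
    (q)_(n_(i+1) - n_i). *)
Lemma FG_clim : clim (fun M => \sum_(m < M) b j m) (FG j.+2 zeta q).
Proof.
have [K hK] := FG_term_bound.
pose F (t : (j.+1).-tuple nat) : C :=
  if @FG_index j.+2 t then @FG_term R j.+2 zeta q t else 0.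
have rho01 : 0 <= rho < 1 by rewrite (ltW rho0).
have Fb t : modulus (F t) <= K * \prod_(x <- t) rho ^+ x.
  rewrite /F; case: ifP => _; first exact: hK.
  by rewrite modulus0; exact: le_trans (modulus_ge0 _) (hK t).
have [s hs] := hsum_ex (tuple_geometric_bounded rho01 Fb).
have -> : FG j.+2 zeta q = s by exact: sum_overE.
have h := hsum_exhaust hs (@bounded_tuples_uniq j.+1).
have {h} := clim_shift 1 (h _).
move=> h e e0; have [|M hM] := h _ e e0.
  move=> t; exists (\max_(x <- t) x).+1 => M tM; apply: mem_bounded_tuples.
  apply/allP => x xt; apply: leq_trans tM; rewrite ltnS.
  exact: (@leq_bigmax_seq _ (tval t) xpredT id x xt isT).
exists M.+1 => -[//|n] Mn; have := hM n Mn; rewrite addn1.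
suff -> : \sum_(i <- bounded_tuples j.+1 n.+1) F i = \sum_(m < n.+1) b j m by [].
pose c (n m : nat) : C := q ^+ (m ^ 2) / P (m - n).
have bE i m : b i m = iter i (chain_step c) (b 0%N) m.
  elim: i m => [//|i ih] m; rewrite iterS -/(iter i _) /chain_step /=.
  by rewrite mulr_sumr; apply: eq_bigr => l _; rewrite ih /c; ring.
rewrite (eq_bigr (fun m : 'I_n.+1 => iter j (chain_step c) (b 0%N) m)); last first.
  by move=> m _; rewrite bE.
rewrite -chain_sum /bounded_tuples big_image /=; apply: eq_bigr => t _.
rewrite /F FGE /FG_index /=.
case: (boolP (sorted leq _)) => //= _.
(* A tuple with n_1 = 0 is excluded by [FG_index]; on the other side its term vanishes because
   beta_0 = 0. *)
move: (map val t) => u. case: (posnP (nth 0%N u 0)) => [_|u0]; first by rewrite mul0r.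
rewrite big_ord_recl exprD -prodrXr /c prodf_div.
rewrite !invfM; set A := (qpoch _ _ _)^-1; set B := (qpoch _ _ _)^-1.
by rewrite /bump /=; ring.
Qed.

End FGLimit.

(** * The generating function as a double series in (r, s) *)

Section DoubleSum.
Variable R : realType.
Local Notation C := R[i].

Lemma clim_geometric_sum (z : C) : modulus z < 1 ->
  clim (fun M => \sum_(m < M) z ^+ m) (1 - z)^-1.
Proof.
move=> z1; apply: (@clim_geometric _ _ _ (modulus z)); first by rewrite modulus_ge0.
exists (modulus (1 - z)^-1) => M.
have z0 : 1 - z != 0.
  by apply: contraTneq z1 => /subr0_eq <-; rewrite modulus1 ltxx.
have -> : \sum_(m < M) z ^+ m = (1 - z ^+ M) / (1 - z).
  by apply: (mulfI z0); rewrite mulrCA divff// mulr1 -[1 - z ^+ M]opprB subrX1; ring.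
rewrite (_ : _ - _ = - ((1 - z)^-1 * z ^+ M)); last by ring.
by rewrite modulusN modulusM modulusX.
Qed.

Variables (j : nat) (tau : C).
Hypothesis htau : upper_half_plane tau.
Local Notation q := (nome tau).
Local Notation rho := (modulus (nome tau)).

Let rho0 : 0 < rho. Proof. by have /andP[] := modulus_nome htau. Qed.
Let rho1 : rho < 1. Proof. by have /andP[] := modulus_nome htau. Qed.

(* Room for absorbing s^l e^(s |y|), for |y| <= d, into a geometric series. *)
Lemma growth_margin : exists2 d : R, 0 < d & rho * expR (4 * d) < 1.
Proof.
have l0 : ln rho < 0 by rewrite ln_lt0// rho0 rho1.
(* With this d, rho * exp(4d) is the square root of rho. *)
exists (- ln rho / 8); first by lra.
rewrite -{1}(lnK rho0) -expRD expR_lt1; lra.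
Qed.

(* The index (i, m) stands for r = i + 1 and s = 2 m + 1. *)
Definition weight (p : nat * nat) : C :=
  (-1) ^+ p.1 * q ^+ (theta_exp j p.1.+1 + p.2.+1 * p.1.+1).

Variable d : R.
Hypothesis d0 : 0 < d.
Let sigma := rho * expR (4 * d).
Hypothesis sigma1 : sigma < 1.

Let sigma0 : 0 < sigma. Proof. by rewrite mulr_gt0 ?expR_gt0. Qed.
Let sigma01 : 0 <= sigma < 1. Proof. by rewrite (ltW sigma0). Qed.

(** With s = 2m + 1, exp(2ds) = exp(2d) exp(4d)^m, whence the 4 in [sigma]. Since sinh(s y) needs
    only exp(ds), another exp(ds) remains to absorb powers of s in the Taylor remainders. *)
Lemma weight_le (phi : nat -> C) (L : R) :
  (forall m, modulus (phi m) <= L * expR (2 * d * (2 * m + 1)%:R)) ->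
  forall p, modulus (weight p * phi p.2) <= L * expR (2 * d) * sigma ^+ (p.1 + p.2).
Proof.
move=> hphi [i m] /=.
have L0 : 0 <= L.
  have := le_trans (modulus_ge0 _) (hphi 0%N).
  by rewrite pmulr_lge0// expR_gt0.
rewrite /weight /= !modulusM !modulusX modulusN modulus1 expr1n mul1r mulrC.
apply: (@le_trans _ _ (L * expR (2 * d * (2 * m + 1)%:R) * rho ^+ (i + m))).
  apply: ler_pM; rewrite ?modulus_ge0 ?exprn_ge0 ?modulus_ge0//.
  apply: ler_wiXn2l; rewrite ?modulus_ge0 ?(ltW rho1)//.
  by have := theta_exp_ge j i.+1; nia.
rewrite -!mulrA ler_wpM2l// /sigma exprMn [leLHS]mulrC [leRHS]mulrCA.
rewrite ler_wpM2l ?exprn_ge0 ?modulus_ge0//.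
rewrite -expRM_natl -expRD ler_expR natrD natrM natrD.
have : 0 <= i%:R :> R by []. have : 0 <= m%:R :> R by [].
have := d0; nra.
Qed.

Lemma weight_bounded (phi : nat -> C) (L : R) :
  (forall m, modulus (phi m) <= L * expR (2 * d * (2 * m + 1)%:R)) ->
  abs_bounded (fun p => weight p * phi p.2) (L * expR (2 * d) / (1 - sigma) ^+ 2).
Proof. by move=> h; apply: pair_geometric_bounded => //; exact: weight_le. Qed.

Definition sinh2 (z : C) := cexp z - cexp (- z).

Variable y : C.
Hypothesis yd : modulus y <= d.
Let Y := cexp y.
Let zeta := cexp (2 * y).

Let cexp_le (z : C) : modulus (cexp z) <= expR (modulus z).
Proof.
by rewrite modulus_cexp ler_expR; apply: le_trans (modulus_ge_Re z); exact: ler_norm.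
Qed.

Let modY (n : nat) : modulus (cexp (n%:R * y)) <= expR (d * n%:R).
Proof.
apply: le_trans (cexp_le _) _; rewrite ler_expR modulusM modulus_nat mulrC.
by rewrite ler_wpM2r.
Qed.

Let modYN (n : nat) : modulus (cexp (- (n%:R * y))) <= expR (d * n%:R).
Proof.
apply: le_trans (cexp_le _) _; rewrite ler_expR modulusN modulusM modulus_nat mulrC.
by rewrite ler_wpM2r.
Qed.

Lemma sinh2_le m : modulus (sinh2 ((2 * m + 1)%:R * y)) <=
  2 * expR (2 * d * (2 * m + 1)%:R).
Proof.
apply: le_trans (modulusB _ _) _.
have := modY (2 * m + 1); have := modYN (2 * m + 1).
have : expR (d * (2 * m + 1)%:R) <= expR (2 * d * (2 * m + 1)%:R).
  by rewrite ler_expR ler_wpM2r//; have := d0; lra.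
lra.
Qed.

Let qY (a : C) i : a = cexp (2 * y) \/ a = cexp (- (2 * y)) ->
  modulus (a * q ^+ i.+1) <= sigma.
Proof.
move=> ha; have ha' : modulus a <= expR (4 * d).
  have h : expR (d * 2%:R) <= expR (4 * d) by rewrite ler_expR; have := d0; lra.
  by case: ha => ->; apply: le_trans h; [exact: modY | exact: modYN].
rewrite mulrC modulusM modulusX /sigma.
apply: ler_pM; rewrite ?modulus_ge0 ?exprn_ge0 ?modulus_ge0//.
by rewrite exprS ler_piMr ?exprn_ile1 ?modulus_ge0// ltW.
Qed.

Let cond1 : modulus (zeta * q) < 1.
Proof. by apply: le_lt_trans sigma1; rewrite -[q]expr1; apply: qY; left. Qed.

Let cond2 : modulus (zeta^-1 * q) < 1.
Proof.
by apply: le_lt_trans sigma1; rewrite -[q]expr1 -cexpN; apply: qY; right.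
Qed.

Let zetaE : zeta = Y ^+ 2. Proof. by rewrite -cexpMn. Qed.
Let Y0 : Y != 0. Proof. exact: cexp_neq0. Qed.

(** At x = q^r, the sum over odd s >= 1 of q^(r(s+1)/2) times 2 sinh(s y): two geometric series. *)
Let hterm (x : C) := x * Y / (1 - x * zeta) - x * Y^-1 / (1 - x * zeta^-1).
Let v i := (-1) ^+ i * q ^+ theta_exp j i.+1 * hterm (q ^+ i.+1).

Let clim_row i :
  clim (fun M => \sum_(m < M) weight (i, nat_of_ord m) * sinh2 ((2 * m + 1)%:R * y)) (v i).
Proof.
set x := q ^+ i.+1.
have h1 : modulus (x * zeta) < 1.
  by rewrite mulrC; apply: le_lt_trans sigma1; apply: qY; left.
have h2 : modulus (x * zeta^-1) < 1.
  by rewrite mulrC -cexpN; apply: le_lt_trans sigma1; apply: qY; right.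
have c1 := climZ (x * Y) (clim_geometric_sum h1).
have c2 := climZ (- (x * Y^-1)) (clim_geometric_sum h2).
have := climZ ((-1) ^+ i * q ^+ theta_exp j i.+1) (climD c1 c2).
rewrite /v /hterm -/x mulNr; apply: clim_ext => M.
rewrite !mulr_sumr -big_split /= mulr_sumr; apply: eq_bigr => m _.
have Ym : cexp ((2 * m + 1)%:R * y) = Y * zeta ^+ m.
  by rewrite cexpMn zetaE addn1 exprS exprM.
have qm : q ^+ (m.+1 * i.+1) = x * x ^+ m by rewrite mulnC exprM exprS.
rewrite /sinh2 cexpN Ym /weight /= exprD qm !(exprMn m x) (invfM Y) exprVn.
by ring.
Qed.

(** For fixed r, the r-th term of Garvan's formula plus the theta terms n = r and n = -r equals
    sinh2 y times the row sum [v], a rational identity in exp(y) and q^r. The rest identifies the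
    sum of the rows with the unordered double sum. *)
Lemma rank_double_sum : exists2 Hy : C,
  hsum (fun p : nat * nat => weight p * sinh2 ((2 * p.2 + 1)%:R * y)) Hy &
  euler_prod q * FG j.+2 zeta q + theta 1 (2 * (j.+2)%:Z - 1) tau = 1 + sinh2 y * Hy.
Proof.
have [Hy hHy] := hsum_ex (weight_bounded sinh2_le); exists Hy => //.
have zeta0 : zeta != 0 := cexp_neq0 _.
have F1 : clim (fun M => \sum_(m < M) bailey_iter q zeta j m) (FG j.+2 zeta q).
  exact: FG_clim.
have B1 : clim (fun M => \sum_(i < M) q ^+ (j.+1 * i.+1 ^ 2) * rank_alpha q zeta i.+1)
    (euler_prod q * FG j.+2 zeta q) by exact: bailey_limit F1.
have L1 := climD B1 (theta_clim j htau).
set K := 2 * expR (2 * d) * (1 - sigma)^-1.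
have K0 : 0 <= K by rewrite /K !mulr_ge0 ?expR_ge0 ?invr_ge0 ?subr_ge0 ?(ltW sigma1).
pose u i M := \sum_(m < M) weight (i, nat_of_ord m) * sinh2 ((2 * m + 1)%:R * y).
have ub i M : modulus (u i M) <= K * sigma ^+ i.
  apply: le_trans (modulus_sum _ _ _) _.
  apply: (@le_trans _ _ (\sum_(m < M) 2 * expR (2 * d) * sigma ^+ (i + m))).
    apply: ler_sum => m _.
    exact: (@weight_le (fun m => sinh2 ((2 * m + 1)%:R * y)) 2 sinh2_le (i, nat_of_ord m)).
  rewrite -mulr_sumr (eq_bigr (fun m : 'I_M => sigma ^+ i * sigma ^+ m)); last first.
    by move=> m _; rewrite exprD.
  rewrite -mulr_sumr /K -[leRHS]mulrA [_^-1 * _]mulrC mulrA [leRHS]mulrA.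
  by rewrite ler_wpM2l ?geometric_sum_le// !mulr_ge0 ?expR_ge0 ?exprn_ge0 ?(ltW sigma0).
have vb i : modulus (v i) <= K * sigma ^+ i by apply: clim_le (clim_row i) _; exact: ub.
have [T hT] := hsum_ex (nat_geometric_bounded sigma01 vb).
have cT : clim (fun M => \sum_(i < M) v i) T.
  have h := @hsum_exhaust _ _ _ _ (fun M => iota 0 M) hT (fun M => iota_uniq 0 M).
  apply: clim_ext (h _) => [M|i].
    by rewrite -(big_mkord xpredT) /index_iota subn0.
  by exists i.+1 => M iM; rewrite mem_iota add0n.
have cu : clim (fun M => \sum_(i < M) u i M) T.
  apply: (@tannery _ u v (fun i => K * sigma ^+ i) (K / (1 - sigma)) T) => // n.
  by rewrite -mulr_sumr ler_wpM2l// geometric_sum_le.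
(* [cu] sums over the squares [0, M)^2, which exhaust the index set of the unordered sum. *)
have TH : T = Hy.
  apply: (clim_uniq cu).
  have h := @hsum_exhaust _ _ _ _ (fun M => [seq (i, m) | i <- iota 0 M, m <- iota 0 M]) hHy.
  apply: clim_ext (h _ _) => [M|M|[i m]].
  - rewrite big_allpairs -{1}[M]subn0 -/(index_iota 0 M) big_mkord; apply: eq_bigr => i _.
    by rewrite -{1}[M]subn0 -/(index_iota 0 M) big_mkord.
  - by apply: allpairs_uniq; rewrite ?iota_uniq// => -[? ?] [? ?].
  - exists (maxn i m).+1 => M hM; apply/allpairsP; exists (i, m).
    by rewrite !mem_iota !add0n /=; split => //; lia.
apply: clim_uniq L1 _; rewrite -TH.
apply: clim_ext (climD (clim_cst 1) (climZ (sinh2 y) cT)) => M.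
rewrite addrCA -big_split /= mulr_sumr; congr (1 + _); apply: eq_bigr => i _.
have den := rank_den_neq0 rho0 rho1 cond1 cond2 i.
rewrite /v /hterm /rank_alpha /rank_num /sinh2 cexpN -/Y.
have -> : q ^+ theta_exp j i.+1 = q ^+ (j.+1 * i.+1 ^ 2) * q ^+ 'C(i.+1, 2).
  by rewrite -exprD.
have -> : q ^+ (2 * i.+1) = q ^+ i.+1 * q ^+ i.+1 by rewrite -exprD addnn mul2n.
move: den; rewrite zetaE mulf_eq0 negb_or /=.
move: (q ^+ (j.+1 * _)) (q ^+ 'C(_, _)) (q ^+ i.+1) (Y0) => A B x.
move: Y => Z Z0 /andP[d1 d2].
have d3 : Z ^+ 2 - x != 0.
  by apply: contraNneq d2 => e; rewrite -[x](subKr (Z ^+ 2)) e subr0 mulVf ?expf_neq0// subrr.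
by rewrite [(-1) ^+ i.+1]exprS; field; rewrite Z0 d1 d3.
Qed.

End DoubleSum.

(** * The functions g_(2,b,l) as moments *)

Section GSeries.
Variable R : realType.
Local Notation C := R[i].
Variables (j : nat) (tau : C).
Hypothesis htau : upper_half_plane tau.
Local Notation q := (nome tau).
Local Notation rho := (modulus (nome tau)).

Lemma hsum_inj2 (I J1 J2 : choiceType) (h1 : J1 -> I) (h2 : J2 -> I)
    (P : pred I) (F : I -> C) s1 s2 :
  injective h1 -> injective h2 ->
  (forall a, P (h1 a)) -> (forall b, P (h2 b)) ->
  (forall a b, h1 a <> h2 b) ->
  (forall i, P i -> (exists a, i = h1 a) \/ (exists b, i = h2 b)) ->
  hsum (F \o h1) s1 -> hsum (F \o h2) s2 ->
  hsum (fun i => if P i then F i else 0) (s1 + s2).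
Proof.
move=> i1 i2 P1 P2 dis cov H1 H2.
pose F1 i := if `[< exists a, i = h1 a >] then F i else 0.
pose F2 i := if `[< exists a, i = h2 a >] then F i else 0.
have e1 : hsum F1 s1.
  apply: (hsum_inj i1) => [i ni|].
    by rewrite /F1; case: asboolP => // -[a] e; case: (ni a e).
  by apply: hsum_ext H1 => a /=; rewrite /F1; case: asboolP => // -[]; exists a.
have e2 : hsum F2 s2.
  apply: (hsum_inj i2) => [i ni|].
    by rewrite /F2; case: asboolP => // -[a] e; case: (ni a e).
  by apply: hsum_ext H2 => a /=; rewrite /F2; case: asboolP => // -[]; exists a.
apply: hsum_ext (hsumD e1 e2) => i; rewrite /F1 /F2.
case: asboolP => [[a ia]|n1]; case: asboolP => [[b ib]|n2].
- by case: (dis a b); rewrite -ia -ib.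
- by rewrite ia P1 addr0.
- by rewrite ib P2 add0r.
- rewrite addr0; case: ifP => // Pi.
  by have [[a ia]|[c ic]] := cov _ Pi; [case: n1; exists a|case: n2; exists c].
Qed.

Variable d : R.
Hypothesis d0 : 0 < d.
Hypothesis sigma1 : rho * expR (4 * d) < 1.

(** A single term of the exponential series at 2ds dominates s^p. *)
Lemma power_growth p : exists L : R, forall m,
  modulus ((2 * m + 1)%:R ^+ p : C) <= L * expR (2 * d * (2 * m + 1)%:R).
Proof.
exists (p`!%:R / (2 * d) ^+ p) => m.
set s := (2 * m + 1)%N; rewrite modulusX modulus_nat.
have x0 : 0 <= 2 * d * s%:R :> R by rewrite mulr_ge0// mulr_ge0// ltW.
have := real_exp_psum_le p.+1 x0; rewrite big_ord_recr /= => h.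
have f0 : 0 < p`!%:R :> R by rewrite ltr0n fact_gt0.
have : (2 * d * s%:R) ^+ p / p`!%:R <= expR (2 * d * s%:R).
  apply: le_trans h; rewrite lerDr; apply: sumr_ge0 => i _.
  by rewrite divr_ge0 ?exprn_ge0.
have dp : 0 < (2 * d) ^+ p by rewrite exprn_gt0// mulr_gt0.
rewrite ler_pdivrMr// exprMn => h2.
by rewrite mulrAC ler_pdivlMr// mulrC (mulrC _ (expR _)).
Qed.

(** A total choice of the value of the sum; for tau in the upper half plane [hsum_moment] shows that
    it is the sum itself, not the default. *)
Definition moment p := xget 0 [set h | hsum (fun x : nat * nat =>
   weight j tau x * (2 * x.2 + 1)%:R ^+ p) h]%classic.

Lemma hsum_moment p :
  hsum (fun x : nat * nat => weight j tau x * (2 * x.2 + 1)%:R ^+ p) (moment p).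
Proof.
have [L hL] := power_growth p.
have [s hs] := hsum_ex (weight_bounded j htau d0 sigma1 hL).
by rewrite /moment; case: xgetP => [x _|/(_ s)].
Qed.

Let b : nat := (2 * j + 3)%N.
Let NN : choiceType := (nat * nat)%type.

(** The slack in the bound on s covers odd s = 2m + 1 and even s = 2m + 2 alike. *)
Let geo_ex (F : nat * nat -> C) (e : nat * nat -> nat) (s : nat -> nat) p :
  (forall x : nat * nat, F x = (s x.2)%:R ^+ p * q ^+ e x) ->
  (forall m, (s m <= 2 * m.+1 + 1)%N) -> (forall x : nat * nat, (x.1 + x.2 <= e x)%N) ->
  exists t, hsum F t.
Proof.
move=> FE sle ele; have /andP[r0 r1] := modulus_nome htau.
have [L hL] := power_growth p.
have L0 : 0 <= L.
  have := le_trans (modulus_ge0 _) (hL 0%N).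
  by rewrite pmulr_lge0// expR_gt0.
pose sg := rho * expR (4 * d); have sg1 : sg < 1 := sigma1.
have sg0 : 0 <= sg by rewrite mulr_ge0 ?expR_ge0 ?ltW.
apply: hsum_ex; apply: (@pair_geometric_bounded _ _ (L * expR (6 * d)) sg).
  by rewrite sg0 sg1.
move=> [i m]; rewrite FE /= modulusM modulusX modulusX modulus_nat.
apply: (@le_trans _ _ (L * expR (2 * d * (2 * m.+1 + 1)%:R) * rho ^+ (i + m))).
  apply: ler_pM; rewrite ?exprn_ge0 ?modulus_ge0//; last first.
    by apply: ler_wiXn2l; rewrite ?(ltW r0) ?(ltW r1)//; exact: (ele (i, m)).
  apply: le_trans (hL m.+1); rewrite modulusX modulus_nat.
  apply: lerXn2r; rewrite ?nnegrE// ler_nat; exact: sle.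
rewrite -!mulrA ler_wpM2l// /sg exprMn [leLHS]mulrC [leRHS]mulrCA.
rewrite ler_wpM2l ?exprn_ge0 ?modulus_ge0//.
rewrite -expRM_natl -expRD ler_expR !natrD natrM -natr1.
have : 0 <= i%:R :> R by []. have : 0 <= m%:R :> R by [].
have := d0; nra.
Qed.

(** In the first sum of g, 2n - bm has the parity of m because b is odd; m = 2i + 1 gives the row r
    = m of the weights. In the second, m - 2bn has the parity of m, and odd m gives the row r = 2n,
    whose weights are negative. For even m both sums run over the same terms. *)
Lemma g_even l : (0 < l)%N -> ~~ odd l ->
  g 2 (2 * (j.+2)%:Z - 1) l tau =
  (1 - 2 ^+ l.-1) * (ratr (bernoulli_number l) / (2 * l%:R)) + moment l.-1.
Proof.
move=> l0 lodd; rewrite /g (gtn_eqF l0) (negPf lodd) -addrA; congr (_ + _).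
set p := l.-1; have bE : 2 * (j.+2)%:Z - 1 = b%:Z by rewrite /b; lia.
rewrite bE.
(* The common even part: difference 2(x.2 + 1) and product of the two indices 2(x.1 + 1)(b(x.1 + 1)
   + x.2 + 1) in both sums. *)
pose cE (x : nat * nat) : C := (2 * x.2.+1)%:R ^+ p *
  q ^+ (2 * x.1.+1 * (b * x.1.+1 + x.2.+1)).
pose W (x : nat * nat) : C := weight j tau x * (2 * x.2 + 1)%:R ^+ p.
pose W0 (x : nat * nat) := W ((2 * x.1)%N, x.2).
pose W1 (x : nat * nat) := W ((2 * x.1).+1, x.2).
have W0E x : W0 x = (2 * x.2 + 1)%:R ^+ p * q ^+ ((2 * x.1 + 1) * (b * x.1 + j + 2 + x.2)).
  case: x => i m; rewrite /W0 /W /weight /theta_exp /=.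
  rewrite exprM sqrrN !expr1n mul1r mulrC; congr (_ * q ^+ _).
  have := bin2_double (2 * i).+1; rewrite /b expnS expn1; nia.
have W1E x : W1 x = - ((2 * x.2 + 1)%:R ^+ p * q ^+ (x.1.+1 * (2 * b * x.1.+1 + 2 * x.2 + 1))).
  case: x => i m; rewrite /W1 /W /weight /theta_exp /=.
  rewrite exprS exprM sqrrN !expr1n mulr1 mulN1r mulNr mulrC; congr (- (_ * q ^+ _)).
  have := bin2_double (2 * i).+2; rewrite /b expnS expn1; nia.
have [s0 hs0] : exists t, hsum W0 t.
  by apply: (@geo_ex W0 (fun x => ((2 * x.1 + 1) * (b * x.1 + j + 2 + x.2))%N)
    (fun m => (2 * m + 1)%N) p W0E) => [m|[i m]] /=; rewrite /b; nia.
have [s1 hs1] : exists t, hsum (fun x => - W1 x) t.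
  apply: (@geo_ex (fun x => - W1 x) (fun x => (x.1.+1 * (2 * b * x.1.+1 + 2 * x.2 + 1))%N)
    (fun m => (2 * m + 1)%N) p (fun x => etrans (congr1 -%R (W1E x)) (opprK _))) => [m|[i m]] /=; rewrite /b; nia.
have [se hse] : exists t, hsum cE t.
  apply: (@geo_ex cE (fun x => (2 * x.1.+1 * (b * x.1.+1 + x.2.+1))%N)
    (fun m => (2 * m.+1)%N) p) => [[i m] //|m|[i m]] /=; rewrite /b; nia.
have -> : moment p = s0 - s1.
  apply: hsum_uniq (hsum_moment p) _.
  apply: (@hsum_ext _ _ (fun x => if xpredT x then W x else 0)) => //.
  apply: (@hsum_inj2 NN NN NN (fun x => ((2 * x.1)%N, x.2)) (fun x => ((2 * x.1).+1, x.2))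
    xpredT W s0 (- s1)) => //.
  - by move=> [a c] [a' c'] /= [] h ->; congr (_, _); lia.
  - by move=> [a c] [a' c'] /= [] h ->; congr (_, _); lia.
  - by move=> [a c] [a' c'] /= [] h _; lia.
  - move=> [i m] _; have [oi|ei] := boolP (odd i); [right|left];
      exists (i./2, m); congr (_, _); rewrite /= mul2n;
      by rewrite -[LHS]odd_double_half ?oi ?(negPf ei).
  by have := hsumZ (-1) hs1; rewrite mulN1r; apply: hsum_ext => x; rewrite mulN1r opprK.
rewrite (_ : s0 - s1 = (s0 + se) - (s1 + se)); last by ring.
congr (_ - _); apply: sum_overE.
  apply: (@hsum_inj2 NN NN NN (fun x => ((2 * x.1 + 1)%N, (b * x.1 + j + 2 + x.2)%N))
     (fun x => ((2 * x.1.+1)%N, (b * x.1.+1 + x.2.+1)%N))) => //.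
  - by move=> [a c] [a' c'] /= [] h1 h2; congr (_, _); nia.
  - by move=> [a c] [a' c'] /= [] h1 h2; congr (_, _); nia.
  - by move=> [a c] /=; rewrite /b; nia.
  - by move=> [a c] /=; rewrite /b; nia.
  - by move=> [a c] [a' c'] /= [] h1 h2; lia.
  - move=> [m n] /and4P[/= m1 n1 h1 h2].
    have {h1 h2} h1 : (b * m + 1 <= 2 * n)%N by clear -h1; nia.
    have [om|em] := boolP (odd m); [left|right].
      exists (m./2, (n - (b * m./2 + j + 2))%N) => /=.
      have := odd_double_half m; rewrite om -mul2n; move: (m./2) => i mE.
      have {}h1 : (b * i + j + 2 <= n)%N by move: h1; rewrite -mE /b; clear; nia.
      by congr (_, _); lia.
    exists (m./2.-1, (n - (b * m./2 + 1))%N) => /=.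
    have := odd_double_half m; rewrite (negPf em) add0n -mul2n; move: (m./2) => i mE.
    have {}h1 : (b * i + 1 <= n)%N by move: h1; rewrite -mE; clear; nia.
    have -> : (i.-1.+1 = i)%N by lia.
    by congr (_, _); lia.
  - apply: hsum_ext hs0 => x; rewrite W0E /=; congr (_ ^+ _ * _).
    by rewrite pmulrn; congr (_%:~R); rewrite /b; lia.
  - apply: hsum_ext hse => x; rewrite /cE /=; congr (_ ^+ _ * _).
    by rewrite pmulrn; congr (_%:~R); rewrite /b; lia.
apply: (@hsum_inj2 NN NN NN (fun x => ((2 * b * x.1.+1 + 2 * x.2 + 1)%N, x.1.+1))
     (fun x => ((2 * b * x.1.+1 + 2 * x.2.+1)%N, x.1.+1))) => //.
- by move=> [a c] [a' c'] /= [] h1 h2; congr (_, _); nia.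
- by move=> [a c] [a' c'] /= [] h1 h2; congr (_, _); nia.
- by move=> [a c] /=; rewrite /b; nia.
- by move=> [a c] /=; rewrite /b; nia.
- by move=> [a c] [a' c'] /= [] h1 h2; nia.
- move=> [m n] /and4P[/= m1 n1 h1 h2].
  pose r := (m - 2 * b * n)%N; have mE : m = (2 * b * n + r)%N by rewrite /r; nia.
  have r0 : (0 < r)%N by nia.
  have := odd_double_half r; rewrite -mul2n => rE.
  have [orr|er] := boolP (odd r); [left|right].
    exists (n.-1, r./2) => /=; rewrite orr in rE; congr (_, _); last by lia.
    by rewrite prednK//; lia.
  exists (n.-1, (r./2).-1) => /=; rewrite (negPf er) in rE; congr (_, _); last by lia.
  by rewrite prednK//; lia.
- apply: hsum_ext hs1 => x; rewrite W1E opprK /=; congr (_ ^+ _ * q ^+ _).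
    by rewrite pmulrn; congr (_%:~R); lia.
  by rewrite mulnC.
- apply: hsum_ext hse => x; rewrite /cE /=; congr (_ ^+ _ * q ^+ _).
    by rewrite pmulrn; congr (_%:~R); lia.
  by lia.
Qed.

End GSeries.

(** * Polynomial approximation at y = 0 *)

Section Jets.
Variable R : realType.
Local Notation C := R[i].
Implicit Types (h k : C -> C) (p r u : {poly C}) (N : nat).

(* y = 0 is excluded because the defining identity of the f_(k,j) fails there
   under x / 0 = 0. *)
Definition jet N h p := exists2 e : R, 0 < e & exists K : R, forall y : C,
  y != 0 -> modulus y < e -> modulus (h y - p.[y]) <= K * modulus y ^+ N.

Lemma jet_ext N h k p : (exists2 e : R, 0 < e & forall y, y != 0 -> modulus y < e -> h y = k y) ->
  jet N h p -> jet N k p.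
Proof.
move=> [e e0 hk] [e' e0' [K hK]]; exists (Num.min e e'); first by rewrite lt_min e0.
by exists K => y y0; rewrite lt_min => /andP[ye ye']; rewrite -hk//; exact: hK.
Qed.

Lemma jet_poly N p : jet N (fun y => p.[y]) p.
Proof.
by exists 1 => //; exists 0 => y _ _; rewrite subrr modulus0 mul0r.
Qed.

Lemma jetD N h k p r : jet N h p -> jet N k r -> jet N (fun y => h y + k y) (p + r).
Proof.
move=> [e e0 [K hK]] [e' e0' [K' hK']]; exists (Num.min e e'); first by rewrite lt_min e0.
exists (K + K') => y y0; rewrite lt_min => /andP[ye ye'].
rewrite hornerD opprD addrACA mulrDl; apply: le_trans (modulusD _ _) _.
by apply: lerD; [exact: hK|exact: hK'].
Qed.

Lemma horner_bound p : exists2 B : R, 0 <= B & forall y : C, modulus y <= 1 -> modulus p.[y] <= B.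
Proof.
exists (\sum_(i < size p) modulus p`_i); first by apply: sumr_ge0 => i _; exact: modulus_ge0.
move=> y y1; rewrite horner_coef; apply: le_trans (modulus_sum _ _ _) _.
apply: ler_sum => i _; rewrite modulusM modulusX ler_piMr ?modulus_ge0//.
by rewrite exprn_ile1 ?modulus_ge0.
Qed.

Lemma jet_bound N h p : jet N h p ->
  exists2 e : R, 0 < e & exists2 B : R, 0 <= B &
    forall y, y != 0 -> modulus y < e -> modulus (h y) <= B.
Proof.
move=> [e e0 [K hK]]; have [B B0 hB] := horner_bound p.
exists (Num.min e 1); first by rewrite lt_min e0 ltr01.
exists (`|K| + B); first by rewrite addr_ge0.
move=> y y0; rewrite lt_min => /andP[ye /ltW y1].
rewrite -[h y](subrK p.[y]); apply: le_trans (modulusD _ _) _; apply: lerD; last exact: hB.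
apply: le_trans (hK y y0 ye) _; apply: le_trans (_ : `|K| * modulus y ^+ N <= _).
  by rewrite ler_wpM2r ?exprn_ge0 ?modulus_ge0// ler_norm.
by rewrite ler_piMr// exprn_ile1 ?modulus_ge0.
Qed.

Lemma jetM N h k p r : jet N h p -> jet N k r -> jet N (fun y => h y * k y) (p * r).
Proof.
move=> jh jk; have [e1 e10 [B B0 hB]] := jet_bound jh.
have [B' B0' hB'] := horner_bound r.
case: jh jk => [e e0 [K hK]] [e' e0' [K' hK']].
exists (Num.min (Num.min e e') (Num.min e1 1)); first by rewrite !lt_min e0 e0' e10 ltr01.
exists (B * K' + `|K| * B') => y y0; rewrite !lt_min => /andP[/andP[ye ye'] /andP[ye1 /ltW y1]].
rewrite hornerM (_ : _ - _ = h y * (k y - r.[y]) + (h y - p.[y]) * r.[y]); last by ring.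
have yN : 0 <= modulus y ^+ N by rewrite exprn_ge0 ?modulus_ge0.
apply: le_trans (modulusD _ _) _; rewrite !modulusM mulrDl; apply: lerD.
  by rewrite -mulrA; apply: ler_pM; rewrite ?modulus_ge0 ?hB ?hK'.
rewrite mulrAC; apply: ler_pM; rewrite ?modulus_ge0 ?hB'//.
by apply: le_trans (hK y y0 ye) _; rewrite ler_wpM2r// ler_norm.
Qed.

Lemma jet_cst N c : jet N (fun=> c) c%:P.
Proof. by apply: jet_ext (jet_poly N c%:P); exists 1 => // y _ _; rewrite hornerC. Qed.

Lemma jet_X N : jet N id 'X.
Proof. by apply: jet_ext (jet_poly N 'X); exists 1 => // y _ _; rewrite hornerX. Qed.

Lemma jetZ N c h p : jet N h p -> jet N (fun y => c * h y) (c *: p).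
Proof. by move=> jh; rewrite -mul_polyC; apply: jetM => //; exact: jet_cst. Qed.

Lemma jetXn N h p i : jet N h p -> jet N (fun y => h y ^+ i) (p ^+ i).
Proof.
move=> jh; elim: i => [|i ih]; first exact: jet_cst.
rewrite exprS; apply: jet_ext (jetM jh ih).
by exists 1 => // y _ _; rewrite exprS.
Qed.

Lemma jet_sum N n (h : nat -> C -> C) (p : nat -> {poly C}) :
  (forall i, jet N (h i) (p i)) ->
  jet N (fun y => \sum_(i < n) h i y) (\sum_(i < n) p i).
Proof.
move=> jh; elim: n => [|n ih].
  rewrite big_ord0; apply: jet_ext (jet_cst N 0); exists 1 => // y _ _.
  by rewrite big_ord0.
rewrite big_ord_recr /=; apply: jet_ext (jetD ih (jh n)).
by exists 1 => // y _ _; rewrite big_ord_recr.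
Qed.

Lemma jet_zero N h (K e : R) : 0 < e ->
  (forall y, y != 0 -> modulus y < e -> modulus (h y) <= K * modulus y ^+ N) -> jet N h 0.
Proof. by move=> e0 hK; exists e => //; exists K => y y0 ye; rewrite horner0 subr0 hK. Qed.

(** As u(0) = 0 and N > 0, h(y) = O(|y|), so the Taylor remainder of exp at h(y) is O(|y|^N). *)
Lemma jet_cexp N h u : (0 < N)%N -> u`_0 = 0 -> jet N h u ->
  jet N (fun y => cexp (h y)) (expp N u).
Proof.
move=> N0 u0 jh; have [v uv] := coef0_mulX u0.
have [B B0 hB] := horner_bound v.
have j1 : jet N (fun y => exp_psum (h y) N) (expp N u).
  have js := @jet_sum N N (fun i y => i`!%:R^-1 * h y ^+ i)
    (fun i => i`!%:R^-1 *: u ^+ i) (fun i => jetZ i`!%:R^-1 (jetXn i jh)).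
  apply: jet_ext js; exists 1 => // y _ _.
  by apply: eq_bigr => i _; rewrite mulrC.
case: (jh) => e e0 [K hK].
pose L := B + `|K|; have L0 : 0 <= L by rewrite addr_ge0.
have hL y : y != 0 -> modulus y < Num.min e 1 -> modulus (h y) <= L * modulus y.
  move=> y0; rewrite lt_min => /andP[ye /ltW y1].
  rewrite -[h y](subrK u.[y]) addrC mulrDl; apply: le_trans (modulusD _ _) _; apply: lerD.
    rewrite uv hornerM hornerX modulusM mulrC ler_wpM2r ?modulus_ge0//; exact: hB.
  apply: le_trans (hK y y0 ye) _.
  apply: le_trans (_ : `|K| * modulus y ^+ N <= _).
    by rewrite ler_wpM2r ?exprn_ge0 ?modulus_ge0// ler_norm.
  by rewrite ler_wpM2l// -[leRHS]expr1 ler_wiXn2l ?modulus_ge0.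
have j0 : jet N (fun y => cexp (h y) - exp_psum (h y) N) 0.
  apply: (@jet_zero _ _ (L ^+ N * expR L) (Num.min e 1)); first by rewrite lt_min e0 ltr01.
  move=> y y0 ye; apply: le_trans (cexp_taylor _ _) _.
  have h1 := hL y y0 ye; rewrite mulrAC -exprMn.
  apply: ler_pM; rewrite ?expR_ge0 ?exprn_ge0 ?modulus_ge0//.
    by apply: lerXn2r; rewrite ?nnegrE ?mulr_ge0 ?modulus_ge0.
  rewrite ler_expR; apply: le_trans h1 _; rewrite ler_piMr//.
  by move: ye; rewrite lt_min => /andP[_ /ltW].
rewrite -[expp N u]add0r; apply: jet_ext (jetD j0 j1).
by exists 1 => // y _ _; rewrite subrK.
Qed.

(** Small real y force the constant coefficient to vanish; then one divides by y and repeats with N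
    - 1. *)
Lemma small_poly_coef0 N p (e K : R) : 0 < e ->
  (forall y : C, y != 0 -> modulus y < e -> modulus p.[y] <= K * modulus y ^+ N) ->
  forall i, (i < N)%N -> p`_i = 0.
Proof.
elim: N p K => // N ih p K e0 hp.
have p0 : p`_0 = 0.
  apply: modulus_eq => d d0; rewrite subr0.
  have [s sE] : exists s, p = (p`_0)%:P + 'X * s.
    have [|s hs] := @coef0_mulX _ (p - (p`_0)%:P); first by rewrite coefB coefC subrr.
    by exists s; rewrite -hs addrC subrK.
  have [B B0 hB] := horner_bound s.
  have L0 : 0 < `|K| + B + 1 by rewrite ltr_wpDl// addr_ge0.
  set L := `|K| + B + 1 in L0.
  (* t lies in the disc, is at most 1, and makes the error t * L smaller than d. *)
  set t := Num.min (Num.min (e / 2) 1) (d / (2 * L)).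
  have t0 : 0 < t by rewrite !lt_min !divr_gt0 ?mulr_gt0 ?ltr01.
  have te : t < e by rewrite /t !gt_min (_ : e / 2 < e)//; lra.
  have t1 : t <= 1 by rewrite /t !ge_min lexx orbT.
  have td : t * L < d.
    have : t <= d / (2 * L) by rewrite /t ge_min lexx orbT.
    rewrite ler_pdivlMr ?mulr_gt0//; lra.
  have mt : modulus (t%:C%C : C) = t by rewrite modulus_real ger0_norm// ltW.
  have tn : (t%:C%C : C) != 0 by rewrite -modulus_gt0 mt.
  have := hp _ tn; rewrite mt => /(_ te) h1.
  have h2 : p`_0 = p.[t%:C%C] - t%:C%C * s.[t%:C%C].
    by rewrite {2}sE hornerD hornerC hornerM hornerX addrK.
  rewrite h2; apply: le_lt_trans (modulusB _ _) _; rewrite modulusM mt.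
  apply: le_lt_trans td; apply: le_trans (_ : `|K| * t + t * B <= _); last first.
    by rewrite /L; lra.
  apply: lerD; last by rewrite ler_wpM2l ?(ltW t0)//; apply: hB; rewrite mt.
  apply: le_trans h1 _; apply: le_trans (_ : `|K| * t ^+ N.+1 <= _).
    by rewrite ler_wpM2r ?exprn_ge0 ?(ltW t0)// ler_norm.
  by rewrite ler_wpM2l// exprS ler_piMr ?exprn_ile1// ltW.
have [s ps] := coef0_mulX p0.
case=> // i iN; rewrite ps coefXM /=; apply: (ih s K) => // y y0 ye.
have := hp y y0 ye; rewrite ps hornerM hornerX modulusM exprS mulrCA.
by rewrite ler_pM2l// modulus_gt0.
Qed.

Lemma jet_uniq N h p r : jet N h p -> jet N h r -> eqmodX N p r.
Proof.
move=> [e e0 [K hK]] [e' e0' [K' hK']] i iN; apply/eqP; rewrite -subr_eq0 -coefB; apply/eqP.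
apply: (@small_poly_coef0 N (p - r) (Num.min e e') (K + K')) => //.
  by rewrite lt_min e0.
move=> y y0; rewrite lt_min => /andP[ye ye'].
rewrite hornerD hornerN mulrDl.
apply: le_trans (modulus_triangle _ (h y) _) _; rewrite modulus_distC.
by apply: lerD; [exact: hK|exact: hK'].
Qed.

Lemma clim_bounded (v : nat -> C) s : clim v s -> exists K, forall n, modulus (v n) <= K.
Proof.
move=> /(_ 1 ltr01)[M hM].
exists (\sum_(i < M) modulus (v i) + (modulus s + 1)) => n.
have s0 : 0 <= \sum_(i < M) modulus (v i) by apply: sumr_ge0 => i _; exact: modulus_ge0.
have [nM|Mn] := ltnP n M.
  rewrite (bigD1 (Ordinal nM))//= -addrA lerDl addr_ge0//.
    by apply: sumr_ge0 => i _; exact: modulus_ge0.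
  by rewrite addr_ge0 ?modulus_ge0.
have := hM n Mn; have := modulus_ge_dist (v n) s; lra.
Qed.

(** Only pointwise convergence is given. Convergence at e/2 bounds |a_i| (e/2)^i by 2B; for |y| <
    e/4 the tail is then dominated by a geometric series of ratio at most 1/2. *)
Lemma power_series_jet (a : nat -> C) (G : C -> C) (e : R) N : 0 < e ->
  (forall y, y != 0 -> modulus y < e -> clim (fun n => \sum_(i < n) a i * y ^+ i) (G y)) ->
  jet N G (\poly_(i < N) a i).
Proof.
move=> e0 hG.
have e2 : 0 < e / 2 by rewrite divr_gt0.
pose t : C := (e / 2)%:C%C.
have mt : modulus t = e / 2 by rewrite modulus_real ger0_norm// ltW.
have tn : t != 0 by rewrite -modulus_gt0 mt.
have te : modulus t < e by rewrite mt; lra.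
have [B hB] := clim_bounded (hG t tn te).
have B0 : 0 <= B by apply: le_trans (hB 0%N); exact: modulus_ge0.
have aB i : modulus (a i) * (e / 2) ^+ i <= 2 * B.
  rewrite -mt -modulusX -modulusM.
  have -> : a i * t ^+ i = \sum_(l < i.+1) a l * t ^+ l - \sum_(l < i) a l * t ^+ l.
    by rewrite big_ord_recr /= addrAC subrr add0r.
  by apply: le_trans (modulusB _ _) _; have := hB i; have := hB i.+1; lra.
exists (e / 4); first by rewrite divr_gt0.
exists (4 * B / (e / 2) ^+ N) => y y0 ye.
have ye' : modulus y < e by lra.
apply: (@clim_dist _ _ _ _ _ (clim_shift N (hG y y0 ye'))) => n.
rewrite horner_poly -!(big_mkord xpredT (fun i => a i * y ^+ i)).
have -> : \sum_(0 <= i < n + N) a i * y ^+ i - \sum_(0 <= i < N) a i * y ^+ i =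
   \sum_(N <= i < n + N) a i * y ^+ i.
  by rewrite [X in X - _](big_cat_nat (n := N)) ?leq_addl//= addrAC subrr add0r.
apply: le_trans (modulus_sum _ _ _) _; rewrite -{1}[N]add0n big_addn addnK big_mkord.
set x := modulus y / (e / 2).
have x01 : 0 <= x by rewrite divr_ge0 ?modulus_ge0// ltW.
have x1 : x <= 1 / 2 by rewrite /x ler_pdivrMr//; lra.
apply: (@le_trans _ _ (\sum_(i < n) 2 * B * x ^+ N * x ^+ i)).
  apply: ler_sum => i _; rewrite modulusM modulusX.
  have -> : modulus y = x * (e / 2) by rewrite /x divfK// gt_eqF.
  rewrite exprMn mulrCA -mulrA -exprD [(N + i)%N]addnC mulrC [leRHS]mulrC.
  by rewrite [leRHS]mulrC ler_wpM2r// exprn_ge0.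
rewrite -mulr_sumr.
apply: (@le_trans _ _ (2 * B * x ^+ N * 2)).
  rewrite ler_wpM2l ?mulr_ge0 ?exprn_ge0//.
  have hx : 0 <= x < 1 by rewrite x01; lra.
  apply: le_trans (geometric_sum_le n hx) _.
  by rewrite -[leRHS]invrK lef_pV2 ?posrE ?invr_gt0//; lra.
by rewrite /x expr_div_n le_eqVlt; apply/predU1P; left; field; rewrite expf_neq0// gt_eqF.
Qed.

Section DoubleSumJet.
Variables (j : nat) (tau : C).
Hypothesis htau : upper_half_plane tau.
Variable d : R.
Hypothesis d0 : 0 < d.
Hypothesis sigma1 : modulus (nome tau) * expR (4 * d) < 1.

(** sinh is replaced by its Taylor polynomial inside the double sum: the main terms sum to moments,
    and the remainder is at most a constant times |y|^N exp(2ds), uniformly in s, so it is summable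
    against the weights. *)
Lemma double_sum_jet (G : C -> C) N :
  (forall y, modulus y <= d ->
    hsum (fun p : nat * nat => weight j tau p * sinh2 ((2 * p.2 + 1)%:R * y)) (G y)) ->
  jet N G (2 *: \poly_(l < N) (if odd l then moment j tau l / l`!%:R else 0)).
Proof.
move=> hG; exists d => //.
pose L : R := 2 * (N`!%:R / d ^+ N).
exists (L * expR (2 * d) / (1 - modulus (nome tau) * expR (4 * d)) ^+ 2) => y y0 /ltW yd.
pose r (m : nat) : C := sinh2 ((2 * m + 1)%:R * y)
  - 2 * \sum_(l < N) (if odd l then ((2 * m + 1)%:R * y) ^+ l / l`!%:R else 0).
have rE m : r m = (cexp ((2 * m + 1)%:R * y) - exp_psum ((2 * m + 1)%:R * y) N)
   - (cexp (- ((2 * m + 1)%:R * y)) - exp_psum (- ((2 * m + 1)%:R * y)) N).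
  rewrite /r /sinh2; set z := _ * y.
  have -> : 2 * \sum_(l < N) (if odd l then z ^+ l / l`!%:R else 0) =
     exp_psum z N - exp_psum (- z) N.
    rewrite /exp_psum -sumrB mulr_sumr; apply: eq_bigr => l _.
    by rewrite exprNn -signr_odd; case: (odd l); rewrite ?expr1 ?expr0; ring.
  by ring.
have hr m : modulus (r m) <= (L * modulus y ^+ N) * expR (2 * d * (2 * m + 1)%:R).
  rewrite rE; apply: le_trans (modulusB _ _) _.
  apply: le_trans (lerD (cexp_taylor _ _) (cexp_taylor _ _)) _.
  rewrite !modulusN modulusM modulus_nat; set s := (2 * m + 1)%:R.
  have s0 : 0 <= s :> R by [].
  have ds0 : 0 <= d * s by rewrite mulr_ge0// ltW.
  have := real_exp_psum_le N.+1 ds0; rewrite big_ord_recr /= => h.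
  have f0 : 0 < N`!%:R :> R by rewrite ltr0n fact_gt0.
  have hs : (d * s) ^+ N / N`!%:R <= expR (d * s).
    apply: le_trans h; rewrite lerDr; apply: sumr_ge0 => i _.
    by rewrite divr_ge0 ?exprn_ge0.
  have dN : 0 < d ^+ N by rewrite exprn_gt0.
  have hs' : s ^+ N <= N`!%:R / d ^+ N * expR (d * s).
    move: hs; rewrite ler_pdivrMr// exprMn => hs.
    by rewrite mulrAC ler_pdivlMr// mulrC (mulrC N`!%:R).
  have he : expR (s * modulus y) <= expR (d * s).
    by rewrite ler_expR mulrC ler_wpM2r.
  have -> : 2 * d * s = d * s + d * s by ring.
  rewrite expRD exprMn -mulr2n -[X in X <= _]mulr_natl /L.
  have -> : 2 * (N`!%:R / d ^+ N) * modulus y ^+ N * (expR (d * s) * expR (d * s)) =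
    2 * ((N`!%:R / d ^+ N * expR (d * s)) * modulus y ^+ N * expR (d * s)) by ring.
  rewrite ler_wpM2l//; apply: ler_pM; rewrite ?mulr_ge0 ?exprn_ge0 ?expR_ge0 ?modulus_ge0//.
  by rewrite ler_wpM2r ?exprn_ge0 ?modulus_ge0.
have hsr : hsum (fun p : nat * nat => weight j tau p * r p.2)
    (G y - (2 *: \poly_(l < N) (if odd l then moment j tau l / l`!%:R else 0)).[y]).
  have hm := @hsum_sum R (nat * nat)%type nat (index_iota 0 N)
    (fun l (x : nat * nat) => (if odd l then 2 * y ^+ l / l`!%:R else 0) *
       (weight j tau x * (2 * x.2 + 1)%:R ^+ l))
    (fun l => (if odd l then 2 * y ^+ l / l`!%:R else 0) * moment j tau l)
    (fun l => hsumZ _ (hsum_moment j htau d0 sigma1 l)).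
  have := hsumB (hG y yd) hm.
  rewrite hornerZ horner_poly mulr_sumr big_mkord.
  rewrite (eq_bigr (fun l : 'I_N => 2 * ((if odd l then moment j tau l / l`!%:R else 0) * y ^+ l))).
    apply: hsum_ext => p; rewrite /r [RHS]mulrBr; congr (_ - _).
    rewrite mulr_sumr mulr_sumr big_mkord; apply: eq_bigr => l _.
    by case: ifP => _; rewrite ?exprMn; ring.
  by move=> l _; case: ifP => _; ring.
have := hsum_le hsr (weight_bounded j htau d0 sigma1 hr).
by move/le_trans; apply; rewrite le_eqVlt; apply/predU1P; left; ring.
Qed.

End DoubleSumJet.
End Jets.

(** * The expansion of exp U and its coefficients *)

Section Expansion.
Variable R : realType.
Local Notation C := R[i].
Variables (j : nat) (f : nat -> C -> C) (tau : C).
Hypothesis hf : krank_expansion j.+2 f.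
Hypothesis htau : upper_half_plane tau.

Let a (l : nat) : C := if l == 0%N then 0 else f l tau * 2 ^+ l / l`!%:R.

Let ipi : C := cpi R * 'i%C.

Let pi0 : cpi R != 0.
Proof. by rewrite -modulus_gt0 modulus_real normr_gt0 gt_eqF// pi_gt0. Qed.

Let i0 : 'i%C != 0 :> C.
Proof. by rewrite eq_complex /= oner_eq0 andbF. Qed.

(** The substitution y = pi i z turns sin(pi z) / (pi z) into sinh2 y / (2y); then denominators are
    cleared by 2y (q)_oo. The radius e * pi reflects |y| = pi |z|. *)
Lemma expansion_near : exists2 e : R, 0 < e & forall y : C, y != 0 -> modulus y < e ->
  exists2 L : C, clim (fun n => \sum_(i < n) a i * y ^+ i) L &
  2 * y * (euler_prod (nome tau) * FG j.+2 (cexp (2 * y)) (nome tau)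
     + theta 1 (2 * (j.+2)%:Z - 1) tau) = sinh2 y * cexp (2 * L).
Proof.
have [e e0 he] := (nbhs_ball_modulus _ _).1 (hf htau).
have mp : modulus ipi = pi.
  rewrite modulusM modulus_real ger0_norm ?pi_ge0//.
  by rewrite /modulus /= expr0n expr1n add0r sqrtr1 mulr1.
have ipi0 : ipi != 0 by rewrite mulf_neq0.
exists (e * pi); first by rewrite mulr_gt0 ?pi_gt0.
move=> y y0 ye; pose z := y / ipi.
have z0 : z != 0 by rewrite mulf_neq0 ?invr_eq0.
have ze : modulus (z - 0) < e.
  by rewrite subr0 modulusM modulusV mp ltr_pdivrMr ?pi_gt0.
have [hc heq] := he z ze z0.
have E0 : euler_prod (nome tau) != 0.
  by have /andP[r0 r1] := modulus_nome htau; have [] := euler_prod_clim r0 r1.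
have tz : two_pi_i R * z = 2 * y by rewrite /two_pi_i -(mulrA 2) -/ipi /z -mulrA [ipi * _]mulrC divfK.
have iz : 'i%C * (cpi R * z) = y by rewrite mulrCA mulrA -/ipi /z mulrC divfK.
have cz : cpi R * z = y / 'i%C by rewrite -iz [X in X / _]mulrC mulfK.
set L := lim _ in heq; exists L.
  have := cvg_clim hc; apply: clim_ext => n.
  rewrite /exponent_psum tz; case: n => [|n]; first by rewrite big_geq// big_ord0.
  rewrite big_add1 /= big_mkord big_ord_recl /a eqxx mul0r add0r.
  by apply: eq_bigr => i _; rewrite /= /bump add1n exprMn; ring.
rewrite tz in heq.
have -> : euler_prod (nome tau) * FG j.+2 (cexp (2 * y)) (nome tau)
     + theta 1 (2 * (j.+2)%:Z - 1) tau = euler_prod (nome tau) *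
  (FG j.+2 (cexp (2 * y)) (nome tau) + theta 1 (2 * (j.+2)%:Z - 1) tau / euler_prod (nome tau)).
  by field.
rewrite heq /csin iz cz -/(sinh2 y).
move: i0 E0; move: ('i%C) (sinh2 y) (euler_prod _) (cexp (2 * L)) => I S E X I0 E0.
by field; rewrite E0 y0 I0.
Qed.

Let u N : {poly C} := \poly_(l < N) (if l == 0%N then 0 else
  2 * (f l tau * 2 ^+ l / l`!%:R)).

Let u0 N : (u N)`_0 = 0. Proof. by rewrite coef_poly; case: ifP. Qed.

Let sinh2_jet N : jet N.+1 (@sinh2 R) (sinh2_poly N.+1 (1 : C)).
Proof.
have jp : jet N.+1 (@cexp R) (expp N.+1 (1 *: 'X)).
  apply: jet_cexp => //; first exact: aX_coef0.
  by rewrite scale1r; exact: jet_X.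
have jm : jet N.+1 (fun y : C => cexp (- y)) (expp N.+1 (- (1 *: 'X))).
  apply: jet_cexp => //; first by rewrite coefN aX_coef0 oppr0.
  rewrite scale1r -scaleN1r; apply: jet_ext (jetZ (-1) (jet_X R N.+1)).
  by exists 1 => // y _ _; rewrite mulN1r.
rewrite /sinh2_poly -[- expp _ _]scaleN1r.
by apply: jet_ext (jetD jp (jetZ (-1) jm)); exists 1 => // y _ _; rewrite mulN1r.
Qed.

(** Both sides of [expansion_near] are approximated to order N + 1 and the polynomials compared;
    [csch_solution] divides by 2 sinh, leaving order N. *)
Lemma expansion_eqmodX N :
  eqmodX N (expp N.+1 (u N.+1)) (csch_poly N.+1 (1 : C) + 4 *: ('X *
     \poly_(l < N.+1) (if odd l then moment j tau l / l`!%:R else 0))).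
Proof.
have [d d0 sigma1] := growth_margin htau.
have [e e0 he] := expansion_near.
set H := \poly_(l < N.+1) _.
apply: csch_solution.
(* The sums exist only for small y; [xget] makes them total functions, as [jet] requires. *)
pose G (y : C) : C := xget 0 [set h | hsum (fun p : nat * nat =>
   weight j tau p * sinh2 ((2 * p.2 + 1)%:R * y)) h]%classic.
have hG y : modulus y <= d -> hsum (fun p : nat * nat =>
    weight j tau p * sinh2 ((2 * p.2 + 1)%:R * y)) (G y) /\
  euler_prod (nome tau) * FG j.+2 (cexp (2 * y)) (nome tau)
     + theta 1 (2 * (j.+2)%:Z - 1) tau = 1 + sinh2 y * G y.
  move=> yd; have [Hy h1 h2] := rank_double_sum j htau d0 sigma1 yd.
  have GH : hsum (fun p : nat * nat =>
    weight j tau p * sinh2 ((2 * p.2 + 1)%:R * y)) (G y).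
    by rewrite /G; case: xgetP => [x _|/(_ Hy)].
  by split=> //; rewrite h2 (hsum_uniq h1 GH).
pose Lf (y : C) : C := xget 0 [set L | clim (fun n => \sum_(i < n) a i * y ^+ i) L]%classic.
have hL y : y != 0 -> modulus y < e -> clim (fun n => \sum_(i < n) a i * y ^+ i) (Lf y).
  move=> y0 ye; have [L hL _] := he y y0 ye.
  by rewrite /Lf; case: xgetP => [x _|/(_ L)].
have jG : jet N.+1 G (2 *: H).
  by apply: (double_sum_jet htau d0 sigma1) => y /hG[].
have jL : jet N.+1 Lf (\poly_(l < N.+1) a l) := power_series_jet N.+1 e0 hL.
have jE : jet N.+1 (fun y => cexp (2 * Lf y)) (expp N.+1 (u N.+1)).
  apply: jet_cexp => //.
  rewrite (_ : u N.+1 = 2 *: \poly_(l < N.+1) a l); first exact: jetZ.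
  apply/polyP => l; rewrite coefZ !coef_poly /a; case: ifP => _; last by rewrite mulr0.
  by case: ifP => _; rewrite ?mulr0.
have j1 := jetM (jetZ 2 (jet_X R N.+1)) (jetD (jet_cst N.+1 1) (jetM (sinh2_jet N) jG)).
have j2 := jetM (sinh2_jet N) jE.
have j3 : jet N.+1 (fun y : C => sinh2 y * cexp (2 * Lf y))
   (2 *: 'X * (1%:P + sinh2_poly N.+1 (1 : C) * (2 *: H))).
  apply: jet_ext j1; exists (Num.min e d); first by rewrite lt_min e0.
  move=> y y0; rewrite lt_min => /andP[ye /ltW yd].
  have [_ <-] := hG y yd; have [L hL' ->] := he y y0 ye.
  by rewrite (clim_uniq (hL y y0 ye) hL').
by have := jet_uniq j3 j2; rewrite -scalerAr.
Qed.

Lemma expansion_coef n i : (0 < i <= n.+1)%N ->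
  (expp n.+2 (u n.+2))`_i = 4 * g 2 (2 * (j.+2)%:Z - 1) i tau / i.-1`!%:R.
Proof.
have [d d0 sigma1] := growth_margin htau.
move=> /andP[i0' iN].
(* [expansion_eqmodX] at N = n + 2 speaks of truncation n + 3; the coefficients up to n + 1 are the
   same. *)
have -> : (expp n.+2 (u n.+2))`_i = (expp n.+3 (u n.+3))`_i.
  have uu : eqmodX n.+2 (u n.+2) (u n.+3).
    by move=> l lN; rewrite !coef_poly lN (leqW lN).
  rewrite (expp_eqmodX uu) ?ltnS//; apply/esym.
  by apply: (@expp_leq C n.+2 n.+3) => //; rewrite ltnS.
rewrite expansion_eqmodX ?ltnS// coefD coefZ coefXM (gtn_eqF i0').
case: i i0' iN => // i _ iN /=; rewrite coef_poly (leqW (leqW iN)).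
have [oi|ei] := boolP (odd i).
  rewrite (g_even j htau d0 sigma1)//=; last by rewrite oi.
  rewrite coef_csch_poly ?expr1n; last exact: leqW.
  have f0 := factnz C i; have i1 : i.+1%:R != 0 :> C by rewrite pnatr_eq0.
  rewrite factS natrM exprS.
  by field; rewrite f0 /= addrC natr1 i1.
rewrite csch_poly_odd//=.
by rewrite /g /= ei; ring.
Qed.

End Expansion.

Unset Implicit Arguments.
Set Strict Implicit.

Theorem theorem1p4 (R : realType) (k : nat) (f : nat -> R[i] -> R[i])
  (hk : (3 <= k)%N) (hf : krank_expansion k f)
  (n : nat) (hn : (1 <= n)%N) (tau : R[i]) (htau : upper_half_plane tau) :
  f n tau =
    n%:R * g 2 (2 * k%:Z - 1) n tau / 2 ^+ n.-1
    - \sum_(2 <= l < n) 'C(n.-1, l.-1)%:R * f l tau *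
        ((n - l)%N%:R * g 2 (2 * k%:Z - 1) (n - l) tau
          / 2 ^ (n%:Z - l%:Z - 2))
  /\
  f n tau =
    \sum_(2 <= l < n.+1) l%:R * g 2 (2 * k%:Z - 1) l tau / 2 ^+ l.-1
      * ((n.-1)`!%:R / (l.-1)`!%:R) * Tr (n - l) psi f tau.
Proof.
case: k hk hf => [//|[//|j]] _ hf; case: n hn => // n _ /=.
have hE := @expansion_coef R j f tau hf htau n.
have g1 : g 2 (2 * (j.+2)%:Z - 1) 1 tau = 0 by [].
split.
  exact: (phi_recurrence (phi := fun l => f l tau)
    (gam := fun l => g 2 (2 * (j.+2)%:Z - 1) l tau) hE g1).
apply: (phi_trace (phi := fun l => f l tau)
    (gam := fun l => g 2 (2 * (j.+2)%:Z - 1) l tau) hE g1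
    (tr := fun m => Tr m psi f tau)) => m mn.
by apply: (@trace_coef R f tau n.+2 m); rewrite ltnS leqW.
Qed.
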